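(* Let $\Omega\subset\mathbb C^m$ be a bounded domain, and let $\mathcal M$ and $\tilde{\mathcal M}$ be closures of polynomial ideals in analytic Hilbert modules contained in $\mathcal O(\Omega)$, with associated holomorphic hermitian sheaves $\mathcal S=\mathcal S^{\mathcal M}$ and $\tilde{\mathcal S}=\mathcal S^{\tilde{\mathcal M}}$. Let $\mathcal Z=\{w\in\Omega: f(w)=0\ \forall f\in\mathcal M\}$. The curvatures of the determinant bundles $\det(\mathcal P_w)$, $w\in\mathcal Z$, are invariants for the holomorphic hermitian sheaf $\mathcal S$: if the hermitian sheaves $\mathcal S$ and $\tilde{\mathcal S}$ are equivalent, then for every $w\in\mathcal Z$ the curvatures of $\det(\mathcal P_w)$ and $\det(\tilde{\mathcal P}_w)$ coincide on some common open neighbourhood of $w$.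
   Context: An analytic Hilbert module over $\mathbb C[z_1,\dots,z_m]$ is a Hilbert space $\mathcal H\subseteq\mathcal O(\Omega)$ (holomorphic functions on the connected open set $\Omega$) possessing a reproducing kernel (holomorphic in the first variable, anti-holomorphic in the second), such that pointwise multiplication by every polynomial is bounded on $\mathcal H$, and such that $\mathbb C[z_1,\dots,z_m]$ is contained and dense in $\mathcal H$. The sheaf $\mathcal S^{\mathcal M}$ is the coherent subsheaf of the sheaf of holomorphic functions on $\Omega$ whose stalk at $w$ is the ideal of $\mathcal O_w$ generated by the germs of functions in $\mathcal M$. Let $K$ be the reproducing kernel of $\mathcal M$. For $w_0\in\Omega$ let $g_1^0,\dots,g_d^0$ be a minimal set of generators of $\mathcal S_{w_0}$ ($d$ depends on $w_0$). By the decomposition theorem of Biswas–Misra–Putinar, on some open neighbourhood $U_{w_0}$ of $w_0$ there are anti-holomorphic maps $w\mapsto K^{(i)}_{w_0}(\cdot,w)\in\mathcal M$, linearly independent at each $w\in U_{w_0}$, with $K(\cdot,w)=\sum_{i=1}^d\overline{g_i^0(w)}K^{(i)}_{w_0}(\cdot,w)$. These are fixed as part of the data. $\mathcal P_{w_0}$ denotes the rank $d$ hermitian vector bundle over $U_{w_0}$ determined by the free sheaf $\mathcal O(U_{w_0})^d$ and the metric $H(w)=(\langle K^{(i)}_{w_0}(\cdot,w),K^{(j)}_{w_0}(\cdot,w)\rangle)_{i,j=1}^d$; concretely, its fibre at $w$ is the span in $\mathcal M$ of the vectors $K^{(i)}_{w_0}(\cdot,w)$, which form an anti-holomorphic frame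 (a holomorphic frame in the variable $\bar w$). Its determinant bundle $\det(\mathcal P_{w_0})$ is the hermitian line bundle with metric $\det H(w)$ and its curvature is the $(1,1)$-form $\sum_{i,j=1}^m\frac{\partial^2}{\partial w_i\partial\bar w_j}\log\det H(w)\,dw_i\wedge d\bar w_j$. On an open set $U\subseteq\Omega\setminus\mathcal Z$, $E(U)$ denotes the hermitian line bundle with frame $w\mapsto K(\cdot,w)$. The objects $\tilde{\mathcal P}_w$, $\tilde E(U)$ are defined in the same way from $\tilde{\mathcal M}$ and its kernel $\tilde K$. Two such hermitian bundles are equivalent if, on a common open neighbourhood (obtained by shrinking the domains), there is an isometric bundle isomorphism covering the identity which is given, relative to the anti-holomorphic frames $\{K^{(i)}_{w_0}(\cdot,w)\}_i$ of $\mathcal P_{w_0}$ and $\{\tilde K^{(i)}_{w_0}(\cdot,w)\}_i$ of $\tilde{\mathcal P}_{w_0}$ (respectively, the frames $K(\cdot,w)$ of $E(U)$ and $\tilde K(\cdot,w)$ of $\tilde E(U)$), by an anti-holomorphic (i.e. holomorphic in $\bar w$) invertible matrix function. The hermitian sheaves $\mathcal S$ and $\tilde{\mathcal S}$ are said to be equivalent if $\mathcal P_w$ is equivalent to $\tilde{\mathcal P}_w$ for all $w\in\mathcal Z$, and $E(U)$ is equivalent to $\tilde E(U)$ for some open $U\subseteq\Omega\setminus\mathcal Z$ on which both are defined. *)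

(* Defs.v *)
(* For [R : realType], the complex field is [R[i]] and C^m is the space of row
   vectors ['rV[R[i]]_m], normed by the maximum modulus of the coordinates. *)
From HB Require Import structures.
From mathcomp Require Import all_boot all_order all_algebra.
From mathcomp Require Import sesquilinear complex.
From mathcomp Require Import all_classical all_reals all_analysis.
(* The notations of [mpoly] clash with those of MathComp-Analysis. *)
From mathcomp Require Import -(notations) mpoly.

Set Implicit Arguments.
Unset Strict Implicit.
Unset Printing Implicit Defensive.
Import Order.TTheory GRing.Theory Num.Theory.
Import numFieldNormedType.Exports.
Local Open Scope classical_set_scope.
Local Open Scope ring_scope.

(* The library equips [K^o], for [K : numFieldType], with the topology given by
   its norm, but leaves [R[i]] itself without a topology. *)
HB.instance Definition _ (R : realType) := NormedModule.copy R[i] R[i]^o.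

Section HolomorphicFunctions.
Variables (R : realType) (m : nat).
Local Notation C := R[i].
Local Notation Cm := 'rV[C]_m.

(* [differentiable] is Frechet differentiability over the scalar field, that
   is, over [R[i]]. *)
Definition holomorphic_on (V : normedModType C) (U : set Cm) (f : Cm -> V) :=
  forall z, U z -> differentiable f z.

Definition conjv (z : Cm) : Cm := map_mx Num.conj z.

Definition antiholomorphic_on (V : normedModType C) (U : set Cm)
    (f : Cm -> V) :=
  holomorphic_on (conjv @^-1` U) (f \o conjv).

(* Germs at [w0] are represented by functions; two functions have the same germ
   when they agree near [w0].  The ideals of germs below are sets of functions
   closed under that relation. *)
Definition holomorphic_germ (w0 : Cm) (f : Cm -> C) :=
  \forall z \near w0, differentiable f z.

(* The ideal of the local ring at [w0] generated by the germs in [S], a set of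
   functions that are holomorphic near [w0]. *)
Definition germ_ideal (w0 : Cm) (S : set (Cm -> C)) : set (Cm -> C) :=
  [set f | exists n (a s : 'I_n -> Cm -> C),
    [/\ forall k, holomorphic_germ w0 (a k),
        forall k, S (s k) &
        \forall z \near w0, f z = \sum_(k < n) a k z * s k z]].

Definition poly_ideal (I : set (mpoly m C)) :=
  [/\ I 0, forall p q, I p -> I q -> I (p + q) &
      forall p q, I q -> I (p * q)].

Definition polyfun (p : mpoly m C) (z : Cm) : C := meval (fun i => z 0 i) p.

End HolomorphicFunctions.

(* A Hilbert space inside O(Omega) is encoded as an abstract Hilbert space with
   a linear map [ahm_eval] to functions that is injective on Omega; values
   outside Omega carry no information. *)
Record analyticHilbertModule (R : realType) (m : nat)
    (Omega : set 'rV[R[i]]_m) := AnalyticHilbertModule {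
  ahm_space :> completeNormedModType R[i];
  ahm_dot : {dot ahm_space for Num.conj};
  ahm_dotE : forall f, `|f| ^+ 2 = ahm_dot f f;
  ahm_eval : ahm_space -> 'rV[R[i]]_m -> R[i];
  ahm_eval_linear : forall a f g z, Omega z ->
    ahm_eval (a *: f + g) z = a * ahm_eval f z + ahm_eval g z;
  ahm_eval_inj : forall f g,
    (forall z, Omega z -> ahm_eval f z = ahm_eval g z) -> f = g;
  ahm_holomorphic : forall f, holomorphic_on Omega (ahm_eval f);
  ahm_kernel : exists K : 'rV[R[i]]_m -> ahm_space,
    (forall f w, Omega w -> ahm_dot f (K w) = ahm_eval f w) /\
    (forall z, Omega z ->
       antiholomorphic_on Omega (fun w => ahm_eval (K w) z));
  ahm_mul_bounded : forall p : mpoly m R[i], exists c : R[i], forall f,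
    exists2 g, forall z, Omega z -> ahm_eval g z = polyfun p z * ahm_eval f z
             & `|g| <= c * `|f|;
  ahm_polys : forall p : mpoly m R[i],
    exists f, forall z, Omega z -> ahm_eval f z = polyfun p z;
  ahm_dense : closure [set f | exists p : mpoly m R[i],
    forall z, Omega z -> ahm_eval f z = polyfun p z] = setT }.

Section Module.
Variables (R : realType) (m : nat) (Omega : set 'rV[R[i]]_m).
Variable H : analyticHilbertModule Omega.
Local Notation C := R[i].
Local Notation Cm := 'rV[C]_m.

Definition ideal_closure (I : set (mpoly m C)) : set H :=
  closure [set f | exists2 p, I p &
    forall z, Omega z -> ahm_eval f z = polyfun p z].

Definition zero_set (M : set H) : set Cm :=
  [set w | Omega w /\ forall f, M f -> ahm_eval f w = 0].

(* [K w] is the function K(., w). *)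
Definition reproducing_kernel (M : set H) (K : Cm -> H) :=
  forall w, Omega w ->
    M (K w) /\ forall f, M f -> ahm_dot H f (K w) = ahm_eval f w.

(* The stalk at [w0] of the sheaf S^M. *)
Definition stalk (M : set H) (w0 : Cm) : set (Cm -> C) :=
  germ_ideal w0 (@ahm_eval _ _ _ H @` M).

Definition minimal_generators (M : set H) (w0 : Cm) (d : nat)
    (g : 'I_d -> Cm -> C) :=
  [/\ forall i, holomorphic_germ w0 (g i),
      germ_ideal w0 (range g) = stalk M w0 &
      forall J : set 'I_d, germ_ideal w0 (g @` J) = stalk M w0 -> J = setT].

(* The data fixed at [w0] by the decomposition theorem of Biswas, Misra and
   Putinar. *)
Record localDecomposition (M : set H) (K : Cm -> H) (w0 : Cm) :=
  LocalDecomposition {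
  ld_nbhd : set Cm;
  ld_rank : nat;
  ld_gen : 'I_ld_rank -> Cm -> C;
  ld_sec : 'I_ld_rank -> Cm -> H;
  ld_nbhd_open : open ld_nbhd;
  ld_nbhd_center : ld_nbhd w0;
  ld_nbhd_sub : ld_nbhd `<=` Omega;
  ld_gen_holomorphic : forall i, holomorphic_on ld_nbhd (ld_gen i);
  ld_gen_minimal : minimal_generators M w0 ld_gen;
  ld_sec_mem : forall i w, ld_nbhd w -> M (ld_sec i w);
  ld_sec_antiholomorphic : forall i, antiholomorphic_on ld_nbhd (ld_sec i);
  ld_sec_free : forall w, ld_nbhd w -> forall c : 'I_ld_rank -> C,
    \sum_i c i *: ld_sec i w = 0 -> forall i, c i = 0;
  ld_decomp : forall w, ld_nbhd w ->
    K w = \sum_i (ld_gen i w)^* *: ld_sec i w }.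

(* A bundle over [fb_base] presented by a frame, its fibres being subspaces of
   [H] with the induced inner product.  It is used only for frames that are
   anti-holomorphic and linearly independent at each point of the base. *)
Record framedBundle := FramedBundle {
  fb_base : set Cm;
  fb_rank : nat;
  fb_frame : 'I_fb_rank -> Cm -> H }.

Definition fibre (E : framedBundle) (w : Cm) : set H :=
  range (fun c : 'I_(fb_rank E) -> C => \sum_i c i *: fb_frame i w).

Definition metric (E : framedBundle) (w : Cm) : 'M[C]_(fb_rank E) :=
  \matrix_(i, j) ahm_dot H (fb_frame i w) (fb_frame j w).

Definition det_metric (E : framedBundle) (w : Cm) : C := \det (metric E w).

Definition P_bundle (M : set H) (K : Cm -> H) (w0 : Cm)
    (D : localDecomposition M K w0) : framedBundle :=
  FramedBundle (ld_nbhd D) (@ld_sec _ _ _ D).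

Definition E_bundle (K : Cm -> H) (U : set Cm) : framedBundle :=
  FramedBundle U (fun _ : 'I_1 => K).

End Module.

Arguments ideal_closure {R m Omega} H I.

Section Curvature.
Variables (R : realType) (m : nat).
Local Notation C := R[i].
Local Notation Cm := 'rV[C]_m.

(* Derivative of [f] at [w] along the real line through [w] directed by [v]. *)
Definition real_dirderiv (v : Cm) (f : Cm -> C) (w : Cm) : C :=
  (derive1 (fun t : R => complex.Re (f (w + t%:C *: v)%R)) 0
   +i* derive1 (fun t : R => complex.Im (f (w + t%:C *: v)%R)) 0)%C.

(* d/dw_i = (d/dx_i - i d/dy_i) / 2 *)
Definition wirtinger (i : 'I_m) (f : Cm -> C) (w : Cm) : C :=
  (real_dirderiv (delta_mx 0 i) f w
   - ('i)%C * real_dirderiv (('i)%C *: delta_mx 0 i) f w) / 2.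

(* d/d(conj w_i) = (d/dx_i + i d/dy_i) / 2 *)
Definition wirtinger_bar (i : 'I_m) (f : Cm -> C) (w : Cm) : C :=
  (real_dirderiv (delta_mx 0 i) f w
   + ('i)%C * real_dirderiv (('i)%C *: delta_mx 0 i) f w) / 2.

(* The value on the tangent vectors [u], [v] of dw_i /\ d(conj w_j). *)
Definition dw_dwbar (i j : 'I_m) (u v : Cm) : C :=
  u 0 i * (v 0 j)^* - v 0 i * (u 0 j)^*.

(* The curvature (1,1)-form of a hermitian line bundle, from the squared norm
   [h] of a frame; [h] takes positive real values where the frame does not
   vanish, hence the real logarithm of its real part. *)
Definition curvature (h : Cm -> C) (w u v : Cm) : C :=
  \sum_(i < m) \sum_(j < m)
    wirtinger i (wirtinger_bar j (fun z => ((ln (complex.Re (h z)))%:C)%C)) w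
    * dw_dwbar i j u v.

End Curvature.

Section Equivalence.
Variables (R : realType) (m : nat) (Omega : set 'rV[R[i]]_m).
Variables (H H' : analyticHilbertModule Omega).
Local Notation C := R[i].
Local Notation Cm := 'rV[C]_m.

(* [phi w] matters only on the fibre of [E] at [w]. *)
Definition bundle_equiv_on (W : set Cm) (E : framedBundle H)
    (E' : framedBundle H') :=
  exists (phi : Cm -> H -> H') (A : Cm -> 'M[C]_(fb_rank E, fb_rank E')),
  [/\ forall w, W w ->
        [/\ set_bij (fibre E w) (fibre E' w) (phi w),
            forall a x y, fibre E w x -> fibre E w y ->
              phi w (a *: x + y) = a *: phi w x + phi w y &
            forall x y, fibre E w x -> fibre E w y ->
              ahm_dot H' (phi w x) (phi w y) = ahm_dot H x y],
      antiholomorphic_on W A,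
      forall w, W w -> exists B : 'M[C]_(fb_rank E', fb_rank E),
        A w *m B = 1%:M /\ B *m A w = 1%:M &
      forall w, W w -> forall i,
        phi w (fb_frame i w) = \sum_j A w i j *: fb_frame j w].

Definition bundle_equiv_at (w0 : Cm) (E : framedBundle H)
    (E' : framedBundle H') :=
  exists W : set Cm, [/\ open W, W w0, W `<=` fb_base E `&` fb_base E' &
    bundle_equiv_on W E E'].

Definition sheaf_equiv (M : set H) (M' : set H') (K : Cm -> H) (K' : Cm -> H')
    (D : forall w, Omega w -> localDecomposition M K w)
    (D' : forall w, Omega w -> localDecomposition M' K' w) :=
  (forall w (hw : Omega w), zero_set M w ->
     bundle_equiv_at w (P_bundle (D w hw)) (P_bundle (D' w hw))) /\
  (exists U : set Cm,
     [/\ open U, U !=set0, U `<=` Omega `\` zero_set M,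
         U `<=` Omega `\` zero_set M' &
         bundle_equiv_on U (E_bundle K U) (E_bundle K' U)]).

End Equivalence.

(* Main.v *)
Require Import Defs.
From HB Require Import structures.
From mathcomp Require Import all_boot all_order all_algebra.
From mathcomp Require Import sesquilinear complex.
From mathcomp Require Import all_classical all_reals all_analysis.
From mathcomp Require Import -(notations) mpoly.
From mathcomp Require Import ring lra.
Set Implicit Arguments.
Unset Strict Implicit.
Unset Printing Implicit Defensive.
Import Order.TTheory GRing.Theory Num.Theory.
Import numFieldNormedType.Exports.
Import Normc.
Local Open Scope classical_set_scope.
Local Open Scope ring_scope.

(** Why the curvatures agree.  An isometric equivalence of the two bundles is
    a matrix [A] of antiholomorphic functions which carries one frame to the
    other, so the Gram matrices of the frames satisfy [G = A G' A^*] and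
    [det G = |a|^2 det G'] with [a = det A] antiholomorphic and nowhere zero.
    Gram determinants of independent vectors are positive ([gram_det_gt0]),
    hence [log det G = log |a|^2 + log det G'].  The mixed Wirtinger
    derivatives of [log |a|^2] vanish: [d/d(conj w_j)] of it is the
    antiholomorphic function [(d_j a) / a], which every [d/dw_i] kills
    ([wirtinger2_log_modulus]).  Additivity of second derivatives then gives
    the result ([wirtinger2D], [curvature_det_equiv]).

    All the analytic work is in justifying that these second derivatives
    exist.  Holomorphy means here complex differentiability at each point and
    nothing more, so one has to know that the derivative of a complex
    differentiable function is again differentiable, which is the content of
    Goursat's theorem.  The route is as follows.  Bisection gives Goursat's
    theorem for rectangles ([goursat]).  For [phi] differentiable on a disc
    around [0], apply it to [z |-> (phi (e^z) - phi 0) / e^z]: by periodicity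
    the horizontal sides of a rectangle of height [2 pi] cancel, so the mean of
    [(phi w - phi 0) / w] over the circle [|w| = r] does not depend on [r], and
    [r -> 0] identifies it with [phi' 0] ([derivative_circle]).  This formula
    bounds the derivative in terms of the function ([cauchy_estimate]) and, for
    a bounded separately holomorphic [F (s, t)], allows one to differentiate
    [dF/ds (0, t)] in [t] under the integral sign ([mixed_derivative]).

    Neither a Gram entry nor [a] is holomorphic, but in restriction to a real
    plane [w + x v + y v'] each of them extends to a bounded separately
    holomorphic function of two complex variables.  Such functions form an
    algebra, so they contain the determinants; the predicate [slice] expresses
    this, and [slice_gram] and [slice_entry] supply the generators. *)

(** * The modulus of a complex number *)

Section ComplexNorm.
Variable R : realType.
Local Notation C := R[i].
Implicit Types x y : C.

Lemma cReD x y : complex.Re (x + y) = complex.Re x + complex.Re y.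
Proof. by case: x y => [a b] [c d]. Qed.

Lemma cImD x y : complex.Im (x + y) = complex.Im x + complex.Im y.
Proof. by case: x y => [a b] [c d]. Qed.

Lemma cReB x y : complex.Re (x - y) = complex.Re x - complex.Re y.
Proof. by case: x y => [a b] [c d]. Qed.

Lemma cImB x y : complex.Im (x - y) = complex.Im x - complex.Im y.
Proof. by case: x y => [a b] [c d]. Qed.

Lemma cReM x y : complex.Re (x * y) =
  complex.Re x * complex.Re y - complex.Im x * complex.Im y.
Proof. by case: x y => [a b] [c d]. Qed.

Lemma cImM x y : complex.Im (x * y) =
  complex.Re x * complex.Im y + complex.Im x * complex.Re y.
Proof. by case: x y => [a b] [c d]. Qed.

Lemma nc_ge0 x : 0 <= normc x.
Proof. by case: x => a b; exact: sqrtr_ge0. Qed.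

Lemma Re_le_nc x : `|complex.Re x| <= normc x.
Proof.
case: x => a b /=; rewrite -sqrtr_sqr ler_sqrt ?addr_ge0 ?sqr_ge0//.
by rewrite lerDl sqr_ge0.
Qed.

Lemma Im_le_nc x : `|complex.Im x| <= normc x.
Proof.
case: x => a b /=; rewrite -sqrtr_sqr ler_sqrt ?addr_ge0 ?sqr_ge0//.
by rewrite lerDr sqr_ge0.
Qed.

Lemma nc_real (t : R) : normc (t%:C)%C = `|t|.
Proof. by rewrite /= expr0n/= addr0 sqrtr_sqr. Qed.

Lemma nc_i : normc ('i%C : C) = 1.
Proof. by rewrite /= expr0n/= add0r expr1n sqrtr1. Qed.

Lemma nc_le_ReIm x : normc x <= `|complex.Re x| + `|complex.Im x|.
Proof.
rewrite {1}[x]complexE (le_trans (le_normcD _ _))// normcM nc_i mul1r.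
by rewrite !nc_real.
Qed.

Lemma nc_conj x : normc (x^*)%C = normc x.
Proof. by case: x => a b /=; rewrite sqrrN. Qed.

Lemma nc_distC x y : normc (x - y) = normc (y - x).
Proof. by rewrite -normcN opprB. Qed.

End ComplexNorm.

(** * Complex derivatives of functions of one variable *)

Section ComplexDerivative.
Variable R : realType.
Local Notation C := R[i].

(** Stated with the real-valued modulus, so that the estimates below are
    inequalities in an ordered field and arithmetic tactics apply to them. *)
Definition cderiv (f : C -> C) (z d : C) := forall e : R, 0 < e ->
  exists2 del : R, 0 < del & forall h, normc h < del ->
    normc (f (z + h) - f z - d * h) <= e * normc h.

Lemma cderiv_lip f z d : cderiv f z d -> exists2 del : R, 0 < del &
  forall h, normc h < del -> normc (f (z + h) - f z) <= (normc d + 1) * normc h.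
Proof.
move=> /(_ 1 ltr01)[del del0 fz]; exists del => // h /fz hd.
rewrite -[_ - f z](subrK (d * h)) (le_trans (le_normcD _ _))// normcM.
by rewrite mulrDl addrC lerD2l.
Qed.

Lemma cderiv_continuous f z d : cderiv f z d -> forall e : R, 0 < e ->
  exists2 del : R, 0 < del &
  forall h, normc h < del -> normc (f (z + h) - f z) <= e.
Proof.
move=> /cderiv_lip[del del0 fz] e e0.
have k0 : 0 < normc d + 1 by rewrite ltr_wpDl ?nc_ge0.
exists (Num.min del (e / (normc d + 1))); first by rewrite lt_min del0 divr_gt0.
move=> h; rewrite lt_min => /andP[/fz h1 h2]; apply: le_trans h1 _.
by rewrite mulrC -ler_pdivlMr// ltW.
Qed.

Lemma cderiv_ext f g z d (r : R) : 0 < r ->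
  (forall h, normc h < r -> f (z + h) = g (z + h)) -> cderiv f z d -> cderiv g z d.
Proof.
move=> r0 fg fz e /fz[del del0 hd].
exists (Num.min del r); first by rewrite lt_min del0.
move=> h; rewrite lt_min => /andP[/hd + /fg <-].
by have := fg 0; rewrite normc0 addr0 => /(_ r0) <-.
Qed.

Lemma cderiv_shift f z w d : cderiv (fun x => f (w + x)) z d -> cderiv f (w + z) d.
Proof.
by move=> fz e /fz[del del0 hd]; exists del => // h /hd; rewrite addrA.
Qed.

Lemma cderiv_translate f z w d : cderiv f (w + z) d -> cderiv (fun x => f (w + x)) z d.
Proof.
by move=> fz e /fz[del del0 hd]; exists del => // h /hd; rewrite addrA.
Qed.

Lemma cderiv_affine (a b z : C) : cderiv (fun x => a + x * b) z b.
Proof.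
move=> e e0; exists 1 => // h _.
have -> : a + (z + h) * b - (a + z * b) - b * h = 0 by ring.
by rewrite normc0 mulr_ge0 ?nc_ge0// ltW.
Qed.

Lemma cderiv_cst (a z : C) : cderiv (fun=> a) z 0.
Proof.
move=> e e0; exists 1 => // h _.
by rewrite mul0r subrr subr0 normc0 mulr_ge0 ?nc_ge0// ltW.
Qed.

Lemma cderivD f g z df dg : cderiv f z df -> cderiv g z dg ->
  cderiv (fun x => f x + g x) z (df + dg).
Proof.
move=> fz gz e e0; have e20 : 0 < e / 2 by rewrite divr_gt0.
have [d1 d10 h1] := fz _ e20; have [d2 d20 h2] := gz _ e20.
exists (Num.min d1 d2); first by rewrite lt_min d10.
move=> h; rewrite lt_min => /andP[/h1 {}h1 /h2 {}h2].
have -> : f (z + h) + g (z + h) - (f z + g z) - (df + dg) * h =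
  (f (z + h) - f z - df * h) + (g (z + h) - g z - dg * h) by ring.
by rewrite (le_trans (le_normcD _ _))// [e]splitr mulrDl lerD.
Qed.

Lemma cderivM f g z df dg : cderiv f z df -> cderiv g z dg ->
  cderiv (fun x => f x * g x) z (df * g z + f z * dg).
Proof.
move=> fz gz e e0.
have [d1 d10 h1] := cderiv_continuous gz ltr01.
pose N : R := normc (g z) + 1 + normc df + normc (f z) + 1.
have N0 : 0 < N by rewrite /N ltr_wpDl// !addr_ge0 ?nc_ge0.
have e30 : 0 < e / (3 * N) by rewrite divr_gt0 ?mulr_gt0.
have [d2 d20 h2] := fz _ e30.
have [d3 d30 h3] := cderiv_continuous gz e30.
have [d4 d40 h4] := gz _ e30.
exists (Num.min (Num.min d1 d2) (Num.min d3 d4)); first by rewrite !lt_min d10 d20 d30.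
move=> h; rewrite !lt_min => /andP[/andP[/h1 {}h1 /h2 {}h2] /andP[/h3 {}h3 /h4 {}h4]].
have -> : f (z + h) * g (z + h) - f z * g z - (df * g z + f z * dg) * h =
  (f (z + h) - f z - df * h) * g (z + h) +
  (df * (g (z + h) - g z)) * h + f z * (g (z + h) - g z - dg * h) by ring.
have -> : e * normc h = e / (3 * N) * normc h * N + e / (3 * N) * normc h * N
     + e / (3 * N) * normc h * N by field; rewrite gt_eqF.
have A0 : 0 <= e / (3 * N) * normc h by rewrite mulr_ge0 ?nc_ge0// ltW.
rewrite (le_trans (le_normcD _ _))// lerD//.
  rewrite (le_trans (le_normcD _ _))// lerD//.
    rewrite normcM ler_pM ?nc_ge0//.
    rewrite -[g (z + h)](subrK (g z)) (le_trans (le_normcD _ _))//.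
    rewrite (@le_trans _ _ (1 + normc (g z))) ?lerD2r// /N.
    by have := nc_ge0 (f z); have := nc_ge0 df; lra.
  rewrite !normcM [leRHS]mulrAC [leRHS]mulrC [in leRHS]mulrC mulrAC.
  rewrite [leLHS]mulrAC ler_wpM2r ?nc_ge0// mulrC ler_pM ?nc_ge0//.
  by rewrite /N; have := nc_ge0 (g z); have := nc_ge0 (f z); lra.
rewrite normcM mulrC ler_pM ?nc_ge0//.
by rewrite /N; have := nc_ge0 (g z); have := nc_ge0 df; lra.
Qed.

Lemma cderiv_comp f g z df dg : cderiv f z df -> cderiv g (f z) dg ->
  cderiv (g \o f) z (dg * df).
Proof.
move=> fz gz e e0.
have [d1 d10 h1] := cderiv_lip fz.
pose N : R := normc df + 1.
have N0 : 0 < N by rewrite /N ltr_wpDl// nc_ge0.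
have e10 : 0 < e / (2 * N) by rewrite divr_gt0 ?mulr_gt0.
have [d2 d20 h2] := gz _ e10.
pose N' : R := normc dg + 1.
have N'0 : 0 < N' by rewrite /N' ltr_wpDl// nc_ge0.
have e20 : 0 < e / (2 * N') by rewrite divr_gt0 ?mulr_gt0.
have [d3 d30 h3] := fz _ e20.
exists (Num.min d1 (Num.min (d2 / N) d3)); first by rewrite !lt_min d10 d30 divr_gt0.
move=> h; rewrite !lt_min => /andP[/h1 {}h1 /andP[hd2 /h3 {}h3]] /=.
pose k := f (z + h) - f z.
have kd2 : normc k < d2.
  by rewrite (le_lt_trans h1)// -/N mulrC -ltr_pdivlMr.
have := h2 _ kd2; rewrite /k [f z + _]addrC subrK -/k => {}h2.
have -> : g (f (z + h)) - g (f z) - dg * df * h =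
   (g (f (z + h)) - g (f z) - dg * k) + dg * (k - df * h) by ring.
rewrite (le_trans (le_normcD _ _))// normcM.
have -> : e * normc h = e / (2 * N) * (N * normc h) + N' * (e / (2 * N') * normc h).
  by field; rewrite !gt_eqF.
rewrite lerD//.
  by rewrite (le_trans h2)// ler_wpM2l// ltW.
by rewrite ler_pM ?nc_ge0// /N' lerDl.
Qed.

Lemma cderiv_conj f z d : cderiv f (z^*)%C d ->
  cderiv (fun x => ((f (x^*)%C)^*)%C) z (d^*)%C.
Proof.
move=> fz e /fz[del del0 hd]; exists del => // h; rewrite -nc_conj => /hd.
by rewrite -[X in X <= _ -> _]nc_conj !rmorphB rmorphM /= conjcK rmorphD nc_conj.
Qed.

End ComplexDerivative.

(** * Derivatives of real functions as first-order approximations *)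

Section RealDerivative.
Variable R : realType.

Lemma is_derive_small (g : R -> R) (x d : R) : is_derive x 1 g d ->
  (forall e : R, 0 < e -> exists2 del : R, 0 < del & forall h, `|h| < del ->
     `|g (x + h) - g x - d * h| <= e * `|h|).
Proof.
move=> [dg dE] e e0.
have : h^-1 *: (g (h *: 1 + x) - g x) @[h --> 0^'] --> d by rewrite -dE.
move=> /cvgrPdist_le /(_ _ e0) [del /= del0 hd]; exists del => // h hdel.
have [->|h0] := eqVneq h 0; first by rewrite mulr0 addr0 subrr subr0 normr0 mulr0.
have /= := hd h; rewrite sub0r normrN => /(_ hdel h0).
rewrite -(ler_pM2r (_ : 0 < `|h|)) ?normr_gt0// -normrM.
rewrite /GRing.scale/= mulr1 mulrBl mulrAC mulVf// mul1r [h + x]addrC.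
by rewrite distrC.
Qed.

Lemma small_is_derive (g : R -> R) (x d : R) :
  (forall e : R, 0 < e -> exists2 del : R, 0 < del & forall h, `|h| < del ->
     `|g (x + h) - g x - d * h| <= e * `|h|) -> is_derive x 1 g d.
Proof.
move=> gx.
have cvg_g : h^-1 *: (g (h *: 1 + x) - g x) @[h --> 0^'] --> d.
  apply/cvgrPdist_le => e e0; have [del del0 hd] := gx _ e0.
  exists del => // h /=; rewrite sub0r normrN => /hd h1 h0.
  rewrite -(ler_pM2r (_ : 0 < `|h|)) ?normr_gt0// -normrM.
  rewrite /GRing.scale/= mulr1 mulrBl mulrAC mulVf// mul1r [h + x]addrC.
  by rewrite distrC.
apply: DeriveDef; first by apply/cvg_ex; exists d.
by rewrite /derive; apply: cvg_lim => //; exact: norm_hausdorff.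
Qed.

End RealDerivative.

(** * The complex exponential *)

Section ComplexExponential.
Variable R : realType.
Local Notation C := R[i].

Definition cexp (z : C) : C :=
  (expR (complex.Re z) * cos (complex.Im z)
   +i* (expR (complex.Re z) * sin (complex.Im z)))%C.

Lemma cexp0 : cexp 0 = 1.
Proof. by rewrite /cexp /= expR0 cos0 sin0 !mul1r. Qed.

Lemma cexpD z w : cexp (z + w) = cexp z * cexp w.
Proof.
case: z w => [a b] [c d]; rewrite /cexp /= expRD cosD sinD.
by apply/eqP; rewrite eq_complex /=; apply/andP; split; apply/eqP; ring.
Qed.

Lemma cexpNK z : cexp (- z) * cexp z = 1.
Proof. by rewrite -cexpD addNr cexp0. Qed.

Lemma nc_cexp z : normc (cexp z) = expR (complex.Re z).
Proof.
case: z => a b; rewrite /cexp /=.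
rewrite !exprMn -mulrDr cos2Dsin2 mulr1 sqrtr_sqr ger0_norm//.
Qed.

Lemma cexp_periodic z : cexp (z + (0 +i* (pi *+ 2))%C) = cexp z.
Proof.
rewrite cexpD [X in _ * X](_ : _ = 1) ?mulr1//.
by rewrite /cexp /= expR0 cos2pi sin2pi mul1r mulr0.
Qed.

(** With [h = x + i y], [e^x cos y - 1 - x] and [e^x sin y - y] are each at most
    [3 e' |h|], from the first-order expansions of the three real functions. *)
Lemma cderiv_cexp0 : cderiv cexp 0 1.
Proof.
move=> e e0.
pose e' := Num.min (e / 6) 1.
have e'0 : 0 < e' by rewrite lt_min divr_gt0// ltr01.
have e'1 : e' <= 1 by rewrite ge_min lexx orbT.
have e'e : e' <= e / 6 by rewrite ge_min lexx.
have [d1 d10 h1] := is_derive_small (is_derive_expR 0) e'0.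
have [d2 d20 h2] := is_derive_small (is_derive_cos 0) e'0.
have [d3 d30 h3] := is_derive_small (is_derive_sin 0) e'0.
exists (Num.min (Num.min d1 (e' / 2)) (Num.min d2 d3)).
  by rewrite !lt_min d10 d20 d30 divr_gt0.
move=> z; rewrite !lt_min => /andP[/andP[z1 ze] /andP[z2 z3]].
have rz := Re_le_nc z; have iz := Im_le_nc z.
have := h1 _ (le_lt_trans rz z1); have := h2 _ (le_lt_trans iz z2).
have := h3 _ (le_lt_trans iz z3).
rewrite cexp0 add0r mul1r.
case: z rz iz ze {z1 z2 z3} => x y /= rz iz ze.
rewrite !add0r expR0 cos0 sin0 oppr0 addr0 mul0r !mul1r subr0 => s3 s2 s1.
set n := Num.sqrt _ in rz iz ze *.
have n0 : 0 <= n by exact: sqrtr_ge0.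
have X1 : `|expR x - 1| <= e'.
  rewrite -[_ - 1](subrK x) (le_trans (ler_normD _ _))//.
  have : e' * `|x| <= 1 * n by rewrite ler_pM// ltW.
  by move: s1 rz ze; lra.
have X0 : `|expR x| <= 2.
  rewrite -[expR x](subrK 1) (le_trans (ler_normD _ _))// normr1.
  by move: X1 e'1; lra.
have ex : e' * `|x| <= e' * n by rewrite ler_wpM2l// ltW.
have ey : e' * `|y| <= e' * n by rewrite ler_wpM2l// ltW.
have Sy : `|sin y| <= 2 * n.
  rewrite -[sin y](subrK y) (le_trans (ler_normD _ _))//.
  have : e' * n <= 1 * n by rewrite ler_wpM2r.
  by move: s3 iz ey; lra.
rewrite (le_trans (nc_le_ReIm (_ +i* _)%C))//= ?oppr0 ?addr0 ?subr0.
have -> : expR x * cos y - 1 - x = (expR x - 1 - x) + expR x * (cos y - 1) by ring.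
have -> : expR x * sin y - y = (expR x - 1) * sin y + (sin y - y) by ring.
rewrite (le_trans (lerD (ler_normD _ _) (ler_normD _ _)))// !normrM.
have : `|expR x| * `|cos y - 1| <= 2 * (e' * n).
  by rewrite ler_pM// (le_trans s2).
have : `|expR x - 1| * `|sin y| <= e' * (2 * n) by rewrite ler_pM.
have : e' * n <= e / 6 * n by rewrite ler_wpM2r.
by move: s1 s3 ex ey; lra.
Qed.

Lemma cderiv_cexp z : cderiv cexp z (cexp z).
Proof.
have h : cderiv (fun x => cexp z * cexp x) 0 (cexp z).
  have := cderivM (cderiv_cst (cexp z) 0) cderiv_cexp0.
  by rewrite mul0r add0r mulr1.
rewrite -[X in cderiv _ X]addr0; apply: cderiv_shift.
by apply: cderiv_ext h => [|w _]; [exact: ltr01|rewrite add0r cexpD].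
Qed.

End ComplexExponential.

(** * Bisection of rectangles *)

Section Bisection.
Variable R : realType.

Lemma dyadic_small (L del : R) : 0 < del -> exists n, L / 2 ^+ n < del.
Proof.
move=> del0; exists (Num.bound (L / del)).
rewrite ltr_pdivrMr ?exprn_gt0// mulrC -ltr_pdivrMr//.
have [L0|L0] := ltP L 0.
  by rewrite (@lt_trans _ _ 0) ?exprn_gt0// pmulr_llt0 ?invr_gt0.
rewrite (lt_trans (archi_boundP _))// ?divr_ge0 ?(ltW del0)//.
by rewrite -natrX ltr_nat ltn_expl.
Qed.

Lemma dyadic_half (L : R) n : L / 2 ^+ n = L / 2 ^+ n.+1 + L / 2 ^+ n.+1.
Proof. by rewrite exprS; field; rewrite expf_neq0. Qed.

Lemma nested_intervals (a : nat -> R) (L : R) :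
  (forall n, a n <= a n.+1 <= a n + L / 2 ^+ n.+1) ->
  exists x, forall n, a n <= x <= a n + L / 2 ^+ n.
Proof.
move=> ha.
have half := dyadic_half L.
have inc n k : a n <= a (n + k)%N.
  elim: k => [|k IH]; rewrite ?addn0// addnS (le_trans IH)//.
  by have /andP[] := ha (n + k)%N.
have dec n k : a (n + k)%N + L / 2 ^+ (n + k) <= a n + L / 2 ^+ n.
  elim: k => [|k IH]; rewrite ?addn0// addnS (le_trans _ IH)//.
  by rewrite [in leRHS]half addrA lerD2r; have /andP[] := ha (n + k)%N.
have L0 n : 0 <= L / 2 ^+ n.
  have /andP[h1 h2] := ha n; have := le_trans h1 h2.
  by rewrite lerDl (half n) => h; rewrite addr_ge0.
have ub n k : a k <= a n + L / 2 ^+ n.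
  have [nk|kn] := leqP n k.
    by rewrite -(subnKC nk) (le_trans _ (dec n (k - n)%N))// lerDl.
  by rewrite -(subnKC (ltnW kn)) (le_trans (inc k (n - k)%N))// lerDl.
have sup_a : has_sup (range a).
  by split; [exists (a 0%N); exists 0%N|exists (a 0%N + L / 2 ^+ 0) => _ [k _ <-]].
exists (sup (range a)) => n; apply/andP; split.
  by apply: sup_upper_bound => //; exists n.
by apply: sup_le_ub; [exact: sup_a.1|move=> _ [k _ <-]].
Qed.

(** If the property fails on a rectangle it fails on a quarter of it, then on a
    quarter of that, and so on; the lower left corners converge to a point
    which lies in all of these rectangles, where the local hypothesis is
    contradicted. *)
Lemma bisection (P : R -> R -> R -> R -> Prop) (a b c d : R) :
  a <= b -> c <= d ->
  (forall a b c d, a <= b -> c <= d ->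
    P a ((a + b) / 2) c ((c + d) / 2) -> P ((a + b) / 2) b c ((c + d) / 2) ->
    P a ((a + b) / 2) ((c + d) / 2) d -> P ((a + b) / 2) b ((c + d) / 2) d ->
    P a b c d) ->
  (forall x y, a <= x <= b -> c <= y <= d -> exists2 del : R, 0 < del &
    forall a b c d, a <= x <= b -> c <= y <= d -> b - a < del -> d - c < del ->
      P a b c d) ->
  P a b c d.
Proof.
move=> ab cd quarter local; apply: contrapT => bad0.
pose L := b - a; pose M := d - c.
have L0 n : 0 <= L / 2 ^+ n by rewrite divr_ge0 ?exprn_ge0// subr_ge0.
have M0 n : 0 <= M / 2 ^+ n by rewrite divr_ge0 ?exprn_ge0// subr_ge0.
pose bad n (z : R * R) := ~ P z.1 (z.1 + L / 2 ^+ n) z.2 (z.2 + M / 2 ^+ n).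
have step n z : exists z', bad n z -> [/\ bad n.+1 z',
    z.1 <= z'.1 <= z.1 + L / 2 ^+ n.+1 & z.2 <= z'.2 <= z.2 + M / 2 ^+ n.+1].
  apply: contrapT => /forallNP none.
  have badz : bad n z by apply: contrapT => nbad; apply: (none z) => /nbad.
  apply: badz; case: z none => x y none /=.
  have mid (z N : R) : (z + (z + N / 2 ^+ n)) / 2 = z + N / 2 ^+ n.+1.
    by rewrite dyadic_half; field; rewrite expf_neq0.
  have half (z N : R) : z + N / 2 ^+ n = z + N / 2 ^+ n.+1 + N / 2 ^+ n.+1.
    by rewrite -addrA -dyadic_half.
  have no z' : x <= z'.1 <= x + L / 2 ^+ n.+1 -> y <= z'.2 <= y + M / 2 ^+ n.+1 ->
      P z'.1 (z'.1 + L / 2 ^+ n.+1) z'.2 (z'.2 + M / 2 ^+ n.+1).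
    by move=> h1 h2; apply: contrapT => h3; apply: (none z').
  apply: quarter; rewrite ?lerDl// !mid.
  - by apply: (no (x, y)); rewrite /= lexx lerDl ?L0 ?M0.
  - rewrite [in X in P _ X]half.
    by apply: (no (x + L / 2 ^+ n.+1, y)); rewrite /= lexx lerDl ?L0 ?M0.
  - rewrite [in X in P _ _ _ X]half.
    by apply: (no (x, y + M / 2 ^+ n.+1)); rewrite /= lexx lerDl ?L0 ?M0.
  - rewrite [in X in P _ X]half [in X in P _ _ _ X]half.
    by apply: (no (x + L / 2 ^+ n.+1, y + M / 2 ^+ n.+1)); rewrite /= lexx lerDl ?L0 ?M0.
have [next hnext] := choice (fun nz : nat * (R * R) => step nz.1 nz.2).
pose z := fix z n := if n is k.+1 then next (k, z k) else (a, c).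
have badz n : bad n (z n).
  elim: n => [|n IH]; last by have [] := hnext (n, z n) IH.
  by rewrite /bad /= !divr1 /L /M !subrKC.
have hz n := hnext (n, z n) (badz n).
have [x hx] : exists x, forall n, (z n).1 <= x <= (z n).1 + L / 2 ^+ n.
  by apply: nested_intervals => n; have [] := hz n.
have [y hy] : exists y, forall n, (z n).2 <= y <= (z n).2 + M / 2 ^+ n.
  by apply: nested_intervals => n; have [] := hz n.
have [||del del0 hdel] := local x y.
- by have := hx 0%N; rewrite /= divr1 subrKC.
- by have := hy 0%N; rewrite /= divr1 subrKC.
have [n Ln] := dyadic_small (Num.max L M) del0.
apply: (badz n); apply: hdel => //; rewrite addrAC subrr add0r (le_lt_trans _ Ln)//.
  by rewrite ler_pM2r ?invr_gt0 ?exprn_gt0// le_max lexx.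
by rewrite ler_pM2r ?invr_gt0 ?exprn_gt0// le_max lexx orbT.
Qed.

End Bisection.

(** * Integrals of continuous functions over segments *)

Section IntervalIntegral.
Variable R : realType.
Implicit Types (g f : R -> R) (a b c e k : R).

Definition rint a b g := \int[lebesgue_measure]_(x in `[a, b]) g x.
Definition cont_on a b g := forall x, a <= x <= b -> {for x, continuous g}.

Lemma cont_onS a b a' b' g : a <= a' -> b' <= b -> cont_on a b g -> cont_on a' b' g.
Proof.
move=> aa bb gab x /andP[ax xb]; apply: gab.
by rewrite (le_trans aa ax) (le_trans xb bb).
Qed.

Lemma cont_on_integrable a b g : cont_on a b g ->
  lebesgue_measure.-integrable `[a, b] (EFin \o g).
Proof.
move=> gab; apply: continuous_compact_integrable; first exact: segment_compact.
apply: continuous_in_subspaceT => x; rewrite inE /= in_itv /= => xab.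
exact: gab.
Qed.

Lemma cont_onB a b f g : cont_on a b f -> cont_on a b g ->
  cont_on a b (fun x => f x - g x).
Proof. by move=> fc gc x xab; apply: continuousB; [exact: fc|exact: gc]. Qed.

Lemma rintB a b f g : cont_on a b f -> cont_on a b g ->
  rint a b (fun x => f x - g x) = rint a b f - rint a b g.
Proof. by move=> fc gc; apply: RintegralB => //; exact: cont_on_integrable. Qed.

Lemma rint_split a b c g : a <= b -> b <= c -> cont_on a c g ->
  rint a c g = rint a b g + rint b c g.
Proof.
move=> ab bc gac; have gi := cont_on_integrable gac.
have := @Rintegral_itvB R g (BLeft a) (BRight c) b gi.
rewrite !bnd_simp => /(_ ab bc) h.
rewrite /rint -(Rintegral_itv_obnd_cbnd (r := b)).
  by rewrite -h addrC subrK.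
apply: integrableS gi => //; apply: subset_itvr; rewrite bnd_simp//.
Qed.

Lemma rint_bound a b g k e : a <= b -> cont_on a b g ->
  (forall x, a <= x <= b -> `|g x - k| <= e) ->
  `|rint a b g - k * (b - a)| <= e * (b - a).
Proof.
move=> ab gc gk.
have mab : lebesgue_measure (`[a, b]%classic : set R) = (b - a)%:E.
  rewrite lebesgue_measure_itv /= lte_fin; case: ltP => //.
  by move=> ba; rewrite (_ : a = b) ?subrr//; apply/eqP; rewrite eq_le ab.
have cst_int (r : R) : rint a b (fun=> r) = r * (b - a).
  by rewrite /rint Rintegral_cst//= mab.
have cc (r : R) : cont_on a b (fun=> r) by move=> x _; exact: cvg_cst.
rewrite -cst_int -rintB//.
rewrite (le_trans (le_normr_Rintegral _ _))//.
  by apply: cont_on_integrable; exact: cont_onB.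
rewrite -cst_int; apply: le_Rintegral => //.
- apply: cont_on_integrable => x xab.
  by apply: (@cvg_norm _ R^o); exact: (cont_onB gc (cc k)).
- exact: cont_on_integrable.
Qed.

End IntervalIntegral.

(** * Goursat's theorem for rectangles *)

Section Goursat.
Variable R : realType.
Local Notation C := R[i].
Implicit Types f : C -> C.

Lemma complexD (a b c d : R) : ((a +i* b) + (c +i* d))%C = ((a + c) +i* (b + d))%C :> C.
Proof. by []. Qed.

Lemma cderiv_cont_hor f (s t : R) d : cderiv f (s +i* t)%C d ->
  {for s, continuous (fun x => complex.Re (f (x +i* t)%C))} /\
  {for s, continuous (fun x => complex.Im (f (x +i* t)%C))}.
Proof.
move=> /cderiv_continuous fc.
have key e : 0 < e -> \forall x \near s,
    normc (f (s +i* t)%C - f (x +i* t)%C) <= e.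
  move=> /fc[del del0 hd]; exists del => // x /= xdel.
  have := hd ((x - s)%:C)%C.
  rewrite nc_real distrC [X in f X](_ : _ = (x +i* t)%C); last first.
    by rewrite complexD addr0 [s + _]addrC subrK.
  by rewrite nc_distC; apply.
split; apply/cvgrPdist_le => e e0; near=> x.
  rewrite -cReB (le_trans (Re_le_nc _))//; near: x; exact: key.
rewrite -cImB (le_trans (Im_le_nc _))//; near: x; exact: key.
Unshelve. all: by end_near. Qed.

Lemma cderiv_cont_ver f (s t : R) d : cderiv f (s +i* t)%C d ->
  {for t, continuous (fun y => complex.Re (f (s +i* y)%C))} /\
  {for t, continuous (fun y => complex.Im (f (s +i* y)%C))}.
Proof.
move=> /cderiv_continuous fc.
have key e : 0 < e -> \forall y \near t,
    normc (f (s +i* t)%C - f (s +i* y)%C) <= e.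
  move=> /fc[del del0 hd]; exists del => // y /= ydel.
  have := hd (0 +i* (y - t))%C; rewrite complexD addr0 [t + _]addrC subrK.
  rewrite nc_distC; apply; apply: le_lt_trans ydel.
  by rewrite (le_trans (nc_le_ReIm _))//= normr0 add0r distrC.
split; apply/cvgrPdist_le => e e0; near=> x.
  rewrite -cReB (le_trans (Re_le_nc _))//; near: x; exact: key.
rewrite -cImB (le_trans (Im_le_nc _))//; near: x; exact: key.
Unshelve. all: by end_near. Qed.

(** Imaginary part of the integral of [f dz] along the boundary of
    [[a, b] x [c, d]].  The real part is the imaginary part for [i f]. *)
Definition rect_integral f a b c d : R :=
  rint a b (fun s => complex.Im (f (s +i* c)%C))
  - rint a b (fun s => complex.Im (f (s +i* d)%C))
  + (rint c d (fun t => complex.Re (f (b +i* t)%C))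
     - rint c d (fun t => complex.Re (f (a +i* t)%C))).

(** Replacing [f] by its first-order approximation at [(x, y)] costs at most
    [e] times the square of the semi-perimeter, and the approximation itself
    contributes [Re k (b - a) (d - c)] on the vertical sides and the opposite
    on the horizontal ones. *)
Lemma rect_integral_small f (x y : R) k (e : R) : 0 < e ->
  cderiv f (x +i* y)%C k -> exists2 del : R, 0 < del &
  forall a b c d, a <= x <= b -> c <= y <= d -> b - a < del -> d - c < del ->
    (forall s t, a <= s <= b -> c <= t <= d -> exists k, cderiv f (s +i* t)%C k) ->
  `|rect_integral f a b c d| <= e * (b - a + (d - c)) ^+ 2.
Proof.
move=> e0 fk; have e20 : 0 < e / 2 by rewrite divr_gt0.
have [del del0 hd] := fk _ e20.
exists (del / 2); first by rewrite divr_gt0.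
move=> a b c d axb cyd bad dcd diff.
have [/andP[ax xb] /andP[cy yd]] := (axb, cyd).
have ab := le_trans ax xb; have cd := le_trans cy yd.
pose l := b - a + (d - c).
have ld : l < del by rewrite /l; lra.
have near_pt s t : a <= s <= b -> c <= t <= d ->
    normc (f (s +i* t)%C - f (x +i* y)%C - k * ((s - x) +i* (t - y))%C) <= e / 2 * l.
  move=> /andP[as_ sb] /andP[ct td].
  have hl : normc ((s - x) +i* (t - y))%C <= l.
    rewrite (le_trans (nc_le_ReIm _))//= /l lerD//.
      by rewrite ler_norml; lra.
    by rewrite ler_norml; lra.
  have := hd _ (le_lt_trans hl ld).
  rewrite complexD ![_ + (_ - _)]addrC !subrK => /le_trans; apply.
  by rewrite ler_wpM2l// ltW.
have diff_pt s t s' t' : a <= s <= b -> c <= t <= d -> a <= s' <= b -> c <= t' <= d ->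
    normc (f (s +i* t)%C - f (s' +i* t')%C - k * ((s - s') +i* (t - t'))%C) <= e * l.
  move=> h1 h2 h3 h4; have := near_pt _ _ h1 h2; set u := _ - _ - _ * _; move=> hu.
  have := near_pt _ _ h3 h4; set v := _ - _ - _ * _; move=> hv.
  rewrite [X in normc X](_ : _ = u - v).
    rewrite (le_trans (le_normcD _ _))// normcN.
    by rewrite [leRHS](_ : _ = e / 2 * l + e / 2 * l) ?lerD//; field.
  rewrite /u /v.
  have -> : ((s - s') +i* (t - t'))%C =
      ((s - x) +i* (t - y))%C - ((s' - x) +i* (t' - y))%C :> C.
    by apply/eqP; rewrite eq_complex /=; apply/andP; split; apply/eqP; ring.
  by ring.
have aI : a <= a <= b by rewrite lexx. have bI : a <= b <= b by rewrite lexx ab.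
have cI : c <= c <= d by rewrite lexx. have dI : c <= d <= d by rewrite lexx cd.
have chor t : c <= t <= d -> cont_on a b (fun s => complex.Im (f (s +i* t)%C)).
  by move=> tcd s sab; have [q /cderiv_cont_hor[]] := diff _ _ sab tcd.
have cver s : a <= s <= b -> cont_on c d (fun t => complex.Re (f (s +i* t)%C)).
  by move=> sab t tcd; have [q /cderiv_cont_ver[]] := diff _ _ sab tcd.
rewrite /rect_integral -!rintB//; try exact: chor; try exact: cver.
have h1 := @rint_bound R a b
  (fun s => complex.Im (f (s +i* c)%C) - complex.Im (f (s +i* d)%C))
   (- complex.Re k * (d - c)) (e * l) ab (cont_onB (chor _ cI) (chor _ dI)).
have h2 := @rint_bound R c d
  (fun t => complex.Re (f (b +i* t)%C) - complex.Re (f (a +i* t)%C))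
   (complex.Re k * (b - a)) (e * l) cd (cont_onB (cver _ bI) (cver _ aI)).
set I1 := rint a b _ in h1 *; set I2 := rint c d _ in h2 *.
have {}h1 : `|I1 - - complex.Re k * (d - c) * (b - a)| <= e * l * (b - a).
  apply: h1 => s sab; have := le_trans (Im_le_nc _) (diff_pt s c s d sab cI sab dI).
  rewrite !cImB.
  have -> : complex.Im (k * ((s - s) +i* (c - d))%C) = - complex.Re k * (d - c).
    by case: (k) => p q /=; ring.
  by [].
have {}h2 : `|I2 - complex.Re k * (b - a) * (d - c)| <= e * l * (d - c).
  apply: h2 => t tcd; have := le_trans (Re_le_nc _) (diff_pt b t a t bI tcd aI tcd).
  rewrite !cReB.
  have -> : complex.Re (k * ((b - a) +i* (t - t))%C) = complex.Re k * (b - a).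
    by case: (k) => p q /=; ring.
  by [].
have -> : I1 + I2 = (I1 - - complex.Re k * (d - c) * (b - a)) +
  (I2 - complex.Re k * (b - a) * (d - c)) by ring.
rewrite (le_trans (ler_normD _ _))// (le_trans (lerD h1 h2))//.
by rewrite -mulrDr -mulrA -expr2.
Qed.

(** The squared semi-perimeter is divided by [4] when passing to a quarter, and
    the boundary integral is the sum of those of the four quarters.  Hence the
    local bound of [rect_integral_small] propagates to the whole rectangle, for
    every [e]. *)
Theorem goursat f (a b c d : R) : a <= b -> c <= d ->
  (forall s t, a <= s <= b -> c <= t <= d -> exists k, cderiv f (s +i* t)%C k) ->
  rect_integral f a b c d = 0.
Proof.
move=> ab cd diff.
pose P e a' b' c' d' := a <= a' -> b' <= b -> c <= c' -> d' <= d ->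
  `|rect_integral f a' b' c' d'| <= e * (b' - a' + (d' - c')) ^+ 2.
suff hP e : 0 < e -> P e a b c d.
  apply/eqP; rewrite -normr_eq0 eq_le normr_ge0 andbT.
  apply/ler_addgt0Pr => e e0; rewrite add0r.
  pose l2 := (b - a + (d - c)) ^+ 2; have l20 : 0 <= l2 by exact: sqr_ge0.
  have l21 : 0 < l2 + 1 by rewrite ltr_wpDl.
  have := hP (e / (l2 + 1)); rewrite divr_gt0// => /(_ isT).
  move=> /(_ (lexx _) (lexx _) (lexx _) (lexx _)) /le_trans; apply.
  rewrite -/l2 -mulrA ler_piMr ?(ltW e0)// mulrC ler_pdivrMr// mul1r lerDl//.
move=> e0; apply: bisection => //.
- move=> {ab cd} a' b' c' d' ab cd; set m := (a' + b') / 2; set n := (c' + d') / 2.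
  move=> P1 P2 P3 P4 aa bb cc dd.
  have [am mb] : a' <= m /\ m <= b' by rewrite /m; split; lra.
  have [cn nd] : c' <= n /\ n <= d' by rewrite /n; split; lra.
  have am' := le_trans aa am; have mb' := le_trans mb bb.
  have cn' := le_trans cc cn; have nd' := le_trans nd dd.
  have chor t : c <= t <= d -> cont_on a' b' (fun s => complex.Im (f (s +i* t)%C)).
    move=> tcd; apply: (cont_onS aa bb) => s sab.
    by have [q /cderiv_cont_hor[]] := diff _ _ sab tcd.
  have cver s : a <= s <= b -> cont_on c' d' (fun t => complex.Re (f (s +i* t)%C)).
    move=> sab; apply: (cont_onS cc dd) => t tcd.
    by have [q /cderiv_cont_ver[]] := diff _ _ sab tcd.
  have := P1 aa mb' cc nd'; have := P2 am' bb cc nd'.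
  have := P3 aa mb' cn' dd; have := P4 am' bb cn' dd.
  rewrite /rect_integral.
  rewrite (@rint_split R a' m b' (fun s => complex.Im (f (s +i* c')%C)))//; last first.
    by apply: chor; rewrite cc/= (le_trans _ dd)// (le_trans _ nd).
  rewrite (@rint_split R a' m b' (fun s => complex.Im (f (s +i* d')%C)))//; last first.
    by apply: chor; rewrite dd andbT (le_trans cc)// (le_trans _ nd).
  rewrite (@rint_split R c' n d' (fun s => complex.Re (f (b' +i* s)%C)))//; last first.
    by apply: cver; rewrite bb andbT (le_trans aa)// (le_trans _ mb).
  rewrite (@rint_split R c' n d' (fun s => complex.Re (f (a' +i* s)%C)))//; last first.
    by apply: cver; rewrite aa/= (le_trans _ bb)// (le_trans _ mb).
  have -> : b' - m = (b' - a') / 2 by rewrite /m; field.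
  have -> : m - a' = (b' - a') / 2 by rewrite /m; field.
  have -> : d' - n = (d' - c') / 2 by rewrite /n; field.
  have -> : n - c' = (d' - c') / 2 by rewrite /n; field.
  rewrite -mulrDl exprMn => h1 h2 h3 h4.
  rewrite [leRHS](_ : _ = e * ((b' - a' + (d' - c')) ^+ 2 * 2^-1 ^+ 2) * 4);
    last by field.
  move: h1 h2 h3 h4; rewrite !ler_norml.
  set l := _ * _ ^+ 2; set z := e * l; clearbody z.
  by move=> /andP[? ?] /andP[? ?] /andP[? ?] /andP[? ?]; apply/andP; split; lra.
move=> x y xab ycd; have [k fk] := diff _ _ xab ycd.
have [del del0 hd] := rect_integral_small e0 fk.
exists del => // a' b' c' d' h1 h2 h3 h4 aa bb cc dd; apply: hd => // s t.
move=> /andP[? ?] /andP[? ?]; apply: diff.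
  by rewrite (le_trans aa)//= (le_trans _ bb).
by rewrite (le_trans cc)//= (le_trans _ dd).
Qed.

End Goursat.

(** * The derivative as a mean over circles *)

Section DerivativeFormula.
Variable R : realType.
Local Notation C := R[i].
Implicit Types (phi : C -> C) (s : R).

Lemma cderivN_id (z : C) : cderiv (fun x => - x) z (-1).
Proof.
have := @cderiv_affine R 0 (-1) z.
by apply: cderiv_ext (ltr01) _ => h _; rewrite add0r mulrN1.
Qed.

(** The quotient [(phi w - a) / w] read in the logarithmic coordinate
    [w = e^z], in which circles around [0] become vertical segments. *)
Lemma cderiv_logquotient phi a d z : cderiv phi (cexp z) d ->
  exists k, cderiv (fun z => (phi (cexp z) - a) * cexp (- z)) z k.
Proof.
move=> hphi; eexists; apply: cderivM.
  apply: (cderivD _ (cderiv_cst (- a) z)).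
  exact: (cderiv_comp (cderiv_cexp z) hphi).
exact: (cderiv_comp (cderivN_id z) (cderiv_cexp (- z))).
Qed.

(** The integral is independent of the radius [e^s] because the two horizontal
    sides of a rectangle of height [2 pi] in the logarithmic coordinate carry
    the same values; as the radius tends to [0] the quotient tends
    uniformly to [d]. *)
Lemma derivative_circle phi (rho s : R) (d : C) : expR s < rho ->
  (forall z, normc z < rho -> exists k, cderiv phi z k) -> cderiv phi 0 d ->
  rint 0 (pi *+ 2) (fun t =>
    complex.Re ((phi (cexp (s +i* t)%C) - phi 0) * cexp (- (s +i* t)%C))) =
  complex.Re d * (pi *+ 2).
Proof.
move=> srho diff phi0.
pose psi z := (phi (cexp z) - phi 0) * cexp (- z).
have dpsi s' t : s' <= s -> exists k, cderiv psi (s' +i* t)%C k.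
  move=> s's; have [k hk] : exists k, cderiv phi (cexp (s' +i* t)%C) k.
    by apply: diff; rewrite nc_cexp/= (le_lt_trans _ srho)// ler_expR.
  exact: cderiv_logquotient hk.
have pi20 : 0 <= (pi *+ 2 : R) by rewrite mulrn_wge0// pi_ge0.
have per s' : psi (s' +i* (pi *+ 2))%C = psi (s' +i* 0)%C.
  have -> : (s' +i* (pi *+ 2))%C = (s' +i* 0)%C + (0 +i* (pi *+ 2))%C :> C.
    by rewrite complexD addr0 add0r.
  rewrite /psi cexp_periodic; congr (_ * _).
  by rewrite -[LHS]cexp_periodic opprD subrK.
have cpsi s' : s' <= s -> cont_on 0 (pi *+ 2) (fun t => complex.Re (psi (s' +i* t)%C)).
  by move=> s's t _; have [k /cderiv_cont_ver[]] := dpsi s' t s's.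
have const s' : s' <= s ->
    rint 0 (pi *+ 2) (fun t => complex.Re (psi (s +i* t)%C)) =
    rint 0 (pi *+ 2) (fun t => complex.Re (psi (s' +i* t)%C)).
  move=> s's; have := @goursat R psi s' s 0 (pi *+ 2) s's pi20.
  rewrite /rect_integral.
  have -> : (fun x => complex.Im (psi (x +i* (pi *+ 2))%C)) =
     (fun x => complex.Im (psi (x +i* 0)%C)) by apply/funext => x; rewrite per.
  rewrite subrr add0r => /(_ _)/subr0_eq; apply => x t /andP[_ xs] _.
  exact: dpsi.
apply/eqP; rewrite -subr_eq0 -normr_eq0 eq_le normr_ge0 andbT.
apply/ler_addgt0Pr => e e0; rewrite add0r.
have pi2 : 0 < (pi *+ 2 : R) by rewrite pmulrn_lgt0// pi_gt0.
have e'0 : 0 < e / (pi *+ 2) by rewrite divr_gt0.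
have [del del0 hd] := phi0 _ e'0.
pose s' := Num.min s (ln (del / 2)).
have s's : s' <= s by rewrite ge_min lexx.
have esd : expR s' < del.
  rewrite (@le_lt_trans _ _ (del / 2))//; last by rewrite ltr_pdivrMr// ltr_pMr// ltr1n.
  by rewrite -[leRHS]lnK ?posrE ?divr_gt0// ler_expR ge_min lexx orbT.
rewrite (const s' s's) -[X in _ * X]subr0.
rewrite (le_trans (rint_bound pi20 (cpsi _ s's) (e := e / (pi *+ 2)) _))//; last first.
  by rewrite subr0 divfK// gt_eqF.
move=> t _; rewrite -cReB (le_trans (Re_le_nc _))// /psi.
set w := cexp (s' +i* t)%C; set w' := cexp (- _).
have w'w : w' * w = 1 by rewrite cexpNK.
have -> : (phi w - phi 0) * w' - d = (phi (0 + w) - phi 0 - d * w) * w'.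
  by rewrite add0r [RHS]mulrBl -[d * w * w']mulrA [w * w']mulrC w'w mulr1.
rewrite normcM (le_trans (ler_wpM2r (nc_ge0 _) (hd w _)))//; first by rewrite nc_cexp.
by rewrite -mulrA -normcM [w * w']mulrC w'w normc1 mulr1.
Qed.

(** The constant is [4] and not [1]: the difference [phi w - phi 0] costs one
    factor [2], treating real and imaginary parts separately the other. *)
Lemma cauchy_estimate phi (rho s M : R) (d : C) : expR s < rho ->
  (forall z, normc z < rho -> exists k, cderiv phi z k) ->
  (forall z, normc z < rho -> normc (phi z) <= M) -> cderiv phi 0 d ->
  normc d <= 4 * M * expR (- s).
Proof.
move=> srho diff bnd phi0.
have rho0 : 0 < rho by rewrite (le_lt_trans _ srho)// expR_ge0.
have pi2 : 0 < (pi *+ 2 : R) by rewrite pmulrn_lgt0// pi_gt0.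
have half phi' d' : (forall z, normc z < rho -> exists k, cderiv phi' z k) ->
    (forall z, normc z < rho -> normc (phi' z) <= M) -> cderiv phi' 0 d' ->
    `|complex.Re d'| <= 2 * M * expR (- s).
  move=> {diff bnd phi0} diff bnd phi0.
  rewrite -(ler_pM2r pi2) -[X in _ * X](gtr0_norm pi2) -normrM.
  rewrite -(derivative_circle srho diff phi0).
  set g := (fun t : R => _).
  suff : `|rint 0 (pi *+ 2) g - 0 * (pi *+ 2 - 0)| <=
      2 * M * expR (- s) * (pi *+ 2 - 0) by rewrite mul0r !subr0.
  apply: rint_bound; first exact: ltW.
    move=> t _; have [k hk] : exists k, cderiv phi' (cexp (s +i* t)%C) k.
      by apply: diff; rewrite nc_cexp.
    by have [k' /cderiv_cont_ver[]] := cderiv_logquotient (phi' 0) hk.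
  move=> t _; rewrite subr0 (le_trans (Re_le_nc _))// normcM nc_cexp /=.
  rewrite ler_wpM2r ?expR_ge0// (le_trans (le_normcD _ _))// normcN.
  by rewrite mulr_natl mulr2n lerD// bnd ?nc_cexp ?normc0.
rewrite (le_trans (nc_le_ReIm _))//.
have -> : 4 * M * expR (- s) = 2 * M * expR (- s) + 2 * M * expR (- s) by ring.
rewrite lerD//; first exact: half bnd phi0.
have Mi z (k : C) : cderiv phi z k -> cderiv (fun z => - 'i%C * phi z) z (- 'i%C * k).
  by move=> hk; have := cderivM (cderiv_cst (- 'i%C : C) z) hk; rewrite mul0r add0r.
have -> : complex.Im d = complex.Re (- 'i%C * d) by case: (d) => a b /=; ring.
apply: half (Mi _ _ phi0).
  by move=> z /diff[k /Mi hk]; eexists; exact: hk.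
by move=> z /bnd; rewrite normcM normcN nc_i mul1r.
Qed.

End DerivativeFormula.

(** * Differentiability of partial derivatives *)

Section SecondDerivative.
Variable R : realType.
Local Notation C := R[i].

Definition rder (f : R -> C) (t : R) (d : C) :=
  is_derive t 1 (fun x => complex.Re (f x)) (complex.Re d) /\
  is_derive t 1 (fun x => complex.Im (f x)) (complex.Im d).

Lemma is_derive_near (f g : R -> R) (x d r : R) : 0 < r ->
  (forall h, `|h| < r -> f (x + h) = g (x + h)) ->
  is_derive x 1 f d -> is_derive x 1 g d.
Proof.
move=> r0 fg /is_derive_small fx; apply: small_is_derive => e /fx[del del0 hd].
exists (Num.min del r); first by rewrite lt_min del0.
move=> h; rewrite lt_min => /andP[/hd + /fg <-].
by have := fg 0; rewrite normr0 addr0 => /(_ r0) <-.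
Qed.

Lemma cderiv_rder (g : C -> C) (t : R) (d : C) : cderiv g (t%:C)%C d ->
  rder (fun x => g (x%:C)%C) t d.
Proof.
move=> gt.
have D (x y : R) : ((x + y)%:C)%C = (x%:C)%C + (y%:C)%C :> C by rewrite complexD addr0.
have Rd (h : R) : complex.Re (d * (h%:C)%C) = complex.Re d * h.
  by rewrite cReM /= mulr0 subr0.
have Id (h : R) : complex.Im (d * (h%:C)%C) = complex.Im d * h.
  by rewrite cImM /= mulr0 add0r.
split; apply: small_is_derive => e /gt[del del0 hd]; exists del => // h hdel.
  rewrite -Rd -!cReB D -(nc_real h) (le_trans (Re_le_nc _))// hd//.
  by rewrite nc_real.
rewrite -Id -!cImB D -(nc_real h) (le_trans (Im_le_nc _))// hd//.
by rewrite nc_real.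
Qed.

Lemma cderiv_ray (f : C -> C) (c d : C) (t : R) : cderiv f ((t%:C)%C * c) d ->
  rder (fun x => f ((x%:C)%C * c)) t (d * c).
Proof.
move=> fd; apply: (cderiv_rder (g := fun z => f (z * c))).
have := @cderiv_affine R 0 c (t%:C)%C.
rewrite -[(t%:C)%C * c]add0r in fd.
move=> /cderiv_comp/(_ fd); apply: cderiv_ext (ltr01) _ => h _ /=.
by rewrite add0r.
Qed.

(** The bound stands in for joint regularity: through [cauchy_estimate] it
    dominates the partial derivatives uniformly on a smaller bidisc. *)
Record biholomorphic (rho M : R) (F Fs Ft : C -> C -> C) : Prop := Biholomorphic {
  bih_s : forall s t, normc s < rho -> normc t < rho -> cderiv (F^~ t) s (Fs s t);
  bih_t : forall s t, normc s < rho -> normc t < rho -> cderiv (F s) t (Ft s t);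
  bih_bound : forall s t, normc s < rho -> normc t < rho -> normc (F s t) <= M }.

(** [2 pi] times the derivative in [x], at [0], of the mean which represents the
    real part of [Fs 0 (x c)]; the circle has radius [rho / 2]. *)
Definition circle_mean (rho : R) (Ft : C -> C -> C) (c : C) : R :=
  rint 0 (pi *+ 2) (fun t => complex.Re (c *
    ((Ft (cexp (ln (rho / 2) +i* t)%C) 0 - Ft 0 0) * cexp (- (ln (rho / 2) +i* t)%C)))).

(** [derivative_circle] writes [Fs 0 (x c)] as a mean of values of [F (s, x c)]
    over a circle in [s].  The [x]-derivative of the integrand is bounded, by
    [cauchy_estimate] in the second variable, so the mean can be
    differentiated under the integral sign. *)
Lemma mixed_derivative_ray (rho M : R) (F Fs Ft : C -> C -> C) (c : C) :
  0 < rho -> normc c <= 1 -> biholomorphic rho M F Fs Ft ->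
  is_derive (0 : R) 1 (fun x : R => complex.Re (Fs 0 ((x%:C)%C * c)))
    (circle_mean rho Ft c / (pi *+ 2)).
Proof.
move=> rho0 c1 [Hs Ht HM].
have pi2 : 0 < (pi *+ 2 : R) by rewrite pmulrn_lgt0// pi_gt0.
have r20 : 0 < rho / 2 by rewrite divr_gt0.
have r2r : rho / 2 < rho by rewrite ltr_pdivrMr// ltr_pMr// ltr1n.
pose s0 := ln (rho / 2).
have es0 : expR s0 = rho / 2 by rewrite /s0 lnK.
have nw t : normc (cexp (s0 +i* t)%C) < rho by rewrite nc_cexp es0.
have n0 : normc (0 : C) < rho by rewrite normc0.
have nray (x : R) : normc ((x%:C)%C * c) <= `|x|.
  by rewrite normcM nc_real ler_piMr.
pose w t := cexp (s0 +i* t)%C; pose w' t := cexp (- (s0 +i* t)%C).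
pose f (x : R) (t : R) : R :=
  complex.Re ((F (w t) ((x%:C)%C * c) - F 0 ((x%:C)%C * c)) * w' t).
pose g (x : R) (t : R) : R :=
  complex.Re (c * ((Ft (w t) ((x%:C)%C * c) - Ft 0 ((x%:C)%C * c)) * w' t)).
have df (x t : R) : `|x| < rho -> is_derive x 1 (f^~ t) (g x t).
  move=> xrho; have xc := le_lt_trans (nray x) xrho.
  pose h y := (F (w t) y - F 0 y) * w' t.
  have hd : cderiv h ((x%:C)%C * c)
      ((Ft (w t) ((x%:C)%C * c) - Ft 0 ((x%:C)%C * c)) * w' t).
    have F0 : cderiv (fun y => - F 0 y) ((x%:C)%C * c) (- Ft 0 ((x%:C)%C * c)).
      have := cderivM (cderiv_cst (-1) _) (Ht _ _ n0 xc).
      rewrite mul0r add0r mulN1r; apply: cderiv_ext (ltr01) _ => h' _.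
      by rewrite mulN1r.
    have := cderivM (cderivD (Ht _ _ (nw t) xc) F0) (cderiv_cst (w' t) ((x%:C)%C * c)).
    by rewrite mulr0 addr0.
  by have [+ _] := cderiv_ray hd; rewrite mulrC.
have contf (x : R) : `|x| < rho -> cont_on 0 (pi *+ 2) (f x).
  move=> xrho t _; have xc := le_lt_trans (nray x) xrho.
  by have [k /cderiv_cont_ver[]] :=
    cderiv_logquotient (F 0 ((x%:C)%C * c)) (Hs _ _ (nw t) xc).
pose s1 := ln (rho / 4).
have es1 : expR s1 = rho / 4 by rewrite /s1 lnK// posrE divr_gt0.
pose N := 4 * M * expR (- s1).
have Ftb s y : normc s < rho -> normc y < rho / 2 -> normc (Ft s y) <= N.
  move=> srho y2; apply: (@cauchy_estimate R (fun z => F s (y + z)) (rho / 2)).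
  - by rewrite es1; lra.
  - move=> z z2; exists (Ft s (y + z)); apply: cderiv_translate; apply: Ht => //.
    by rewrite (le_lt_trans (le_normcD _ _))// [rho]splitr ltrD.
  - move=> z z2; apply: HM => //.
    by rewrite (le_lt_trans (le_normcD _ _))// [rho]splitr ltrD.
  - by apply: cderiv_translate; rewrite addr0; apply: Ht => //; exact: lt_trans y2 r2r.
pose G := fun _ : R => (N + N) * expR (- s0).
have gG (x t : R) : `|x| < rho / 2 -> `|g x t| <= G t.
  move=> x2; rewrite (le_trans (Re_le_nc _))// !normcM -[leRHS]mul1r.
  rewrite ler_pM ?mulr_ge0 ?nc_ge0// ler_pM ?nc_ge0//; last by rewrite /w' nc_cexp/=.
  have xc := le_lt_trans (nray x) x2.
  rewrite (le_trans (le_normcD _ _))// normcN.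
  by rewrite lerD ?(Ftb _ _ (nw t) xc) ?(Ftb _ _ n0 xc).
have small (x : R) : `](- (rho / 2)), (rho / 2)[%classic x -> `|x| < rho / 2.
  by rewrite /= in_itv /= => ?; rewrite ltr_norml.
have I0 : `](- (rho / 2)), (rho / 2)[%classic (0 : R).
  by rewrite /= in_itv /= oppr_lt0 r20.
have mB : measurable (`[0, pi *+ 2]%classic : set (measurableTypeR R)).
  exact: measurable_itv.
have intf (x : R) : `](- (rho / 2)), (rho / 2)[%classic x ->
    lebesgue_measure.-integrable `[0, pi *+ 2] (EFin \o f x).
  by move=> /small x2; apply/cont_on_integrable/contf/(lt_trans x2).
have derf (x t : R) : `](- (rho / 2)), (rho / 2)[%classic x ->
    `[0, pi *+ 2]%classic t -> derivable (f^~ t) x 1.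
  by move=> /small x2 _; have [] := df x t (lt_trans x2 r2r).
have partial_f (x t : R) : `|x| < rho / 2 -> partial1of2 f x t = g x t.
  by move=> x2; rewrite partial1of2E; have [_ ->] := df x t (lt_trans x2 r2r).
have G0 t : 0 <= G t by apply: (le_trans (normr_ge0 _)) (gG 0 t _); rewrite normr0.
have intG : lebesgue_measure.-integrable `[0, pi *+ 2] (EFin \o G).
  by apply: cont_on_integrable => t _; exact: cvg_cst.
have Gub (x t : R) : `](- (rho / 2)), (rho / 2)[%classic x -> `[0, pi *+ 2]%classic t ->
    `|partial1of2 f x t| <= G t.
  by move=> /small x2 _; rewrite partial_f// gG.
have D1 := @derivable_under_integral R _ _ (@lebesgue_measure R) f _ mB
  _ _ _ I0 intf derf _ G0 intG Gub.
have D2 := @differentiation_under_integral R _ _ (@lebesgue_measure R) f _ mB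
  _ _ _ I0 intf derf _ G0 intG Gub.
have E : is_derive (0 : R) 1 (fun x => rint 0 (pi *+ 2) (f x)) (circle_mean rho Ft c).
  apply: DeriveDef; first exact: D1.
  rewrite -derive1E D2 /circle_mean /rint; apply: eq_Rintegral => t _.
  by rewrite partial_f ?normr0// /g mul0r.
have -> : (circle_mean rho Ft c / (pi *+ 2)) = (pi *+ 2)^-1 *: circle_mean rho Ft c.
  by rewrite /GRing.scale/= mulrC.
have E' := is_deriveZ (pi *+ 2)^-1 E.
apply: is_derive_near r20 _ E' => h h2; rewrite add0r.
rewrite -[LHS]/((pi *+ 2)^-1 * rint 0 (pi *+ 2) (f h)).
have hc := le_lt_trans (nray h) (lt_trans h2 r2r).
have := @derivative_circle R (fun s => F s ((h%:C)%C * c)) rho s0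
  (Fs 0 ((h%:C)%C * c)).
rewrite es0 => /(_ r2r _ (Hs _ _ n0 hc)); rewrite /f => ->.
  by rewrite mulrC mulfK// gt_eqF.
by move=> z zrho; eexists; exact: Hs.
Qed.

Lemma biholomorphicZ (rho M : R) (F Fs Ft : C -> C -> C) (k : C) : normc k = 1 ->
  biholomorphic rho M F Fs Ft ->
  biholomorphic rho M (fun s t => k * F s t) (fun s t => k * Fs s t)
    (fun s t => k * Ft s t).
Proof.
move=> k1 [Hs Ht HM].
have Z f z d : cderiv f z d -> cderiv (fun x => k * f x) z (k * d).
  by move=> fz; have := cderivM (cderiv_cst k z) fz; rewrite mul0r add0r.
split=> s t hs ht; [exact: Z (Hs _ _ _ _)|exact: Z (Ht _ _ _ _)|].
by rewrite normcM k1 mul1r HM.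
Qed.

(** The derivatives of [t |-> Fs 0 t] along the directions [1] and [-i] are
    related as those of a complex differentiable function. *)
Theorem mixed_derivative (rho M : R) (F Fs Ft : C -> C -> C) :
  0 < rho -> biholomorphic rho M F Fs Ft -> exists d : C,
  rder (fun x : R => Fs 0 (x%:C)%C) 0 d /\
  rder (fun x : R => Fs 0 ((x%:C)%C * - 'i%C)) 0 (- 'i%C * d).
Proof.
move=> rho0 HF.
(* [T c] is the derivative of [Re (Fs 0)] along [c].  The other derivatives
   are also values of [T]: by the case of [k F], that of [Re (k Fs 0)] along
   [c] is [T (c k)], and [Im z = Re (- i z)]. *)
pose T c := circle_mean rho Ft c / (pi *+ 2).
have meanZ k c : circle_mean rho (fun s t => k * Ft s t) c = circle_mean rho Ft (c * k).
  rewrite /circle_mean; congr (rint _ _ _); apply/funext => t; congr complex.Re.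
  by ring.
have D k c : normc k = 1 -> normc c = 1 ->
    is_derive (0 : R) 1 (fun x : R => complex.Re (k * Fs 0 ((x%:C)%C * c))) (T (c * k)).
  move=> k1 c1; rewrite /T -meanZ.
  by apply: mixed_derivative_ray (biholomorphicZ k1 HF); rewrite ?c1.
have i1 : normc (- 'i%C : C) = 1 by rewrite normcN nc_i.
have n1 : normc (1 : C) = 1 := normc1 _.
have Ni z : complex.Re (- 'i%C * z : C) = complex.Im z by rewrite cReM /=; ring.
have ext (f g : R -> R) d : (forall x, f x = g x) -> is_derive (0 : R) 1 f d ->
    is_derive (0 : R) 1 g d.
  by move=> fg; refine (@is_derive_near f g 0 d 1 ltr01 _) => h _; rewrite fg.
exists (T 1 +i* T (- 'i%C))%C.
have D11 : is_derive (0 : R) 1 (fun x : R => complex.Re (Fs 0 (x%:C)%C)) (T 1).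
  by have := D _ _ n1 n1; rewrite mulr1; apply: ext => x; rewrite mul1r mulr1.
(* Both sides are derivatives at [0] of the function [x |-> - Re (Fs 0 x)]. *)
have TN : T (- 1) = - T 1.
  have DN1 := D (- 1) 1 _ n1; rewrite normcN in DN1.
  have {}DN1 := DN1 n1; rewrite mulrN1 in DN1.
  have DN := is_deriveN D11.
  have DN' : is_derive (0 : R) 1
      (- (fun x : R => complex.Re (Fs 0 (x%:C)%C))) (T (- 1)).
    apply: ext DN1 => x; rewrite mulr1 mulN1r -[RHS]/(- complex.Re (Fs 0 (x%:C)%C)).
    by case: (Fs 0 _).
  by case: DN => _ <-; case: DN' => _ <-.
split; split => /=.
- exact: D11.
- by have := D _ _ i1 n1; rewrite mul1r; apply: ext => x; rewrite Ni mulr1.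
- have := D _ _ n1 i1; rewrite mulr1 => h.
  rewrite [X in is_derive _ _ _ X](_ : _ = T (- 'i%C)); last by ring.
  by apply: ext h => x; rewrite mul1r.
- have := D _ _ i1 i1; rewrite mulrNN -expr2 sqr_i => h.
  rewrite [X in is_derive _ _ _ X](_ : _ = T (- 1)); last by rewrite TN; ring.
  by apply: ext h => x; rewrite Ni.
Qed.

End SecondDerivative.

(** * Complex derivatives of vector-valued functions *)

Section VectorDerivative.
Variable R : realType.
Local Notation C := R[i].

Lemma conjE (z : C) : Num.conj z = (z^*)%C.
Proof. by []. Qed.

Lemma normrE (z : C) : `|z| = ((normc z)%:C)%C.
Proof. by case: z. Qed.

Section Norm.
Variable V : normedModType C.

(** The norm of a normed space over the complex field takes complex values. *)
Definition nrm (x : V) : R := complex.Re `|x|.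

Lemma nrmE x : `|x| = ((nrm x)%:C)%C.
Proof.
have := normr_ge0 x; rewrite /nrm lecE/= => /andP[/eqP + _].
by case: `|x| => a b /= ->.
Qed.

Lemma nrm_ge0 x : 0 <= nrm x.
Proof. by have := normr_ge0 x; rewrite nrmE ler0c. Qed.

Lemma nrmD x y : nrm (x + y) <= nrm x + nrm y.
Proof. by have := ler_normD x y; rewrite !nrmE complexD addr0 lecR. Qed.

Lemma nrmZ a x : nrm (a *: x) = normc a * nrm x.
Proof.
apply: (@complexI R); rewrite -nrmE normrZ normrE nrmE.
by rewrite rmorphM.
Qed.

Definition vderiv (f : C -> V) (z : C) (d : V) := forall e : R, 0 < e ->
  exists2 del : R, 0 < del & forall h, normc h < del ->
    nrm (f (z + h) - f z - h *: d) <= e * normc h.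

Lemma vderiv_continuous f z d : vderiv f z d -> forall e : R, 0 < e ->
  exists2 del : R, 0 < del &
  forall h, normc h < del -> nrm (f (z + h) - f z) <= e.
Proof.
move=> /(_ _ ltr01)[del del0 fz] e e0.
have k0 : 0 < nrm d + 1 by rewrite ltr_wpDl ?nrm_ge0.
exists (Num.min del (e / (nrm d + 1))); first by rewrite lt_min del0 divr_gt0.
move=> h; rewrite lt_min => /andP[/fz h1 h2].
rewrite -[_ - f z](subrK (h *: d)) (le_trans (nrmD _ _))// nrmZ.
rewrite ltr_pdivlMr// mulrDr mulr1 in h2.
by rewrite (le_trans _ (ltW h2))// addrC lerD2l -[leRHS]mul1r.
Qed.

Lemma derivable_vderiv m (S : 'rV[C]_m -> V) (p u : 'rV[C]_m) (z : C) :
  differentiable S (p + z *: u) ->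
  vderiv (fun x => S (p + x *: u)) z ('D_u S (p + z *: u)).
Proof.
move=> /(diff_derivable (v := u)) dS e e0.
have e0' : 0 < (e%:C)%C by rewrite ltcR.
have : h^-1 *: (S (h *: u + (p + z *: u)) - S (p + z *: u)) @[h --> 0^'] -->
  'D_u S (p + z *: u) by exact: dS.
move=> /cvgrPdist_le /(_ _ e0') [del /= del0 hd].
exists (complex.Re del).
  by move: del0; rewrite ltcE => /andP[].
move=> h hdel; have [->|h0] := eqVneq h 0.
  rewrite addr0 subrr scale0r subr0 normc0 mulr0.
  by rewrite -[0 : V](scale0r 0) nrmZ normc0 mul0r.
have delE : del = ((complex.Re del)%:C)%C.
  by move: del0; rewrite ltcE/= => /andP[/eqP + _]; case: (del) => a b /= ->.
have /= := hd h; rewrite sub0r normrN normrE delE ltcR => /(_ hdel h0).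
rewrite nrmE lecR => hle.
have -> : p + (z + h) *: u = h *: u + (p + z *: u).
  by rewrite scalerDl [RHS]addrC addrA.
set X := S _ - S _ in hle *.
have -> : X - h *: 'D_u S (p + z *: u) = - h *: ('D_u S (p + z *: u) - h^-1 *: X).
  by rewrite scalerBr scalerA mulNr divff// scaleN1r opprK scaleNr addrC.
by rewrite nrmZ normcN mulrC ler_wpM2r ?nc_ge0.
Qed.

End Norm.

Section Entry.
Variables (k l : nat).

Lemma nc_entry (A : 'M[C]_(k, l)) i j : normc (A i j) <= nrm A.
Proof.
have : `|A i j| <= mx_norm A.
  rewrite mx_normE -[leLHS]nngE num_le.
  exact: (le_bigmax _ (fun ij : 'I_k * 'I_l => `|A ij.1 ij.2|%:nng) (i, j)).
by rewrite -[mx_norm A]/(`|A|) normrE nrmE lecR.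
Qed.

Lemma vderiv_entry (f : C -> 'M[C]_(k, l)) z d i j : vderiv f z d ->
  cderiv (fun x => f x i j) z (d i j).
Proof.
move=> fz e /fz[del del0 hd]; exists del => // h /hd; apply: le_trans.
by apply: le_trans (nc_entry _ i j); rewrite !mxE mulrC.
Qed.

End Entry.

Section Dot.
Variables (m : nat) (Omega : set 'rV[C]_m) (H : analyticHilbertModule Omega).
Local Notation dot := (ahm_dot H).

(** Cauchy-Schwarz: expand the squared norm of [x - a y], where [a y] is the
    orthogonal projection of [x] on the line of [y]. *)
Lemma nc_dot (x y : H) : normc (dot x y) <= nrm x * nrm y.
Proof.
have [->|y0] := eqVneq y 0.
  by rewrite linear0r normc0 mulr_ge0 ?nrm_ge0.
have dy0 : dot y y != 0.
  rewrite -ahm_dotE expf_eq0/= normr_eq0//.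
have [a aE] : exists a, a * dot y y = dot x y.
  by exists (dot x y / dot y y); rewrite divfK.
have : 0 <= dot (x - a *: y) (x - a *: y) by rewrite dnorm_ge0.
rewrite linearBl/= !linearBr/= !linearZl_LR/= !linearZr_LR/=.
rewrite [X in 0 <= X](_ : _ = dot x x - a * dot y x); last first.
  by rewrite -aE; rewrite /GRing.scale/=; ring.
have yx : dot y x = (dot x y)^* by rewrite hermC /= expr0 mul1r.
have yy0 : 0 < dot y y by rewrite lt_def dy0 dnorm_ge0.
rewrite -(pmulr_lge0 _ yy0) mulrBl mulrAC aE yx -normCK subr_ge0.
rewrite -!ahm_dotE -exprMn ler_pXn2r ?nnegrE ?mulr_ge0//.
by rewrite normrE !nrmE -rmorphM lecR.
Qed.

Lemma dot_scaler (h : C) (x y : H) : dot x ((h^*)%C *: y) = h * dot x y.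
Proof. by rewrite linearZr_LR /= -[in LHS]conjE conjCK. Qed.

(** The inner product is conjugate-linear on the right, so conjugating the
    argument of [g] restores complex differentiability. *)
Lemma vderiv_dot (f g : C -> H) (z df dg : _) :
  vderiv f z df -> vderiv g (z^*)%C dg ->
  cderiv (fun x => dot (f x) (g (x^*)%C)) z (dot df (g (z^*)%C) + dot (f z) dg).
Proof.
move=> fz gz e e0.
have [d1 d10 h1] := vderiv_continuous gz ltr01.
pose N : R := nrm (g (z^*)%C) + 1 + nrm df + nrm (f z) + 1.
have gN := nrm_ge0 (g (z^*)%C); have dN := nrm_ge0 df; have fN := nrm_ge0 (f z).
have N0 : 0 < N by rewrite /N; lra.
have e30 : 0 < e / (3 * N) by rewrite divr_gt0 ?mulr_gt0.
have [d2 d20 h2] := fz _ e30.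
have [d3 d30 h3] := vderiv_continuous gz e30.
have [d4 d40 h4] := gz _ e30.
exists (Num.min (Num.min d1 d2) (Num.min d3 d4)); first by rewrite !lt_min d10 d20 d30.
move=> h; rewrite !lt_min => /andP[/andP[hd1 /h2 {}h2] /andP[hd3 hd4]].
have {}h1 := h1 (h^*)%C; rewrite nc_conj in h1; have {}h1 := h1 hd1.
have {}h3 := h3 (h^*)%C; rewrite nc_conj in h3; have {}h3 := h3 hd3.
have {}h4 := h4 (h^*)%C; rewrite nc_conj in h4; have {}h4 := h4 hd4.
rewrite rmorphD.
set G := g (z^* + h^*)%C in h1 h3 h4 *; set g0 := g (z^*)%C in h1 h3 h4 *.
have -> : dot (f (z + h)) G - dot (f z) g0 - (dot df g0 + dot (f z) dg) * h =
  dot (f (z + h) - f z - h *: df) G + h * dot df (G - g0) +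
  dot (f z) (G - g0 - (h^*)%C *: dg).
  rewrite !linearBl !linearBr/= linearZl_LR/= dot_scaler.
  by ring.
have -> : e * normc h = e / (3 * N) * normc h * N + e / (3 * N) * normc h * N
     + e / (3 * N) * normc h * N by field; rewrite gt_eqF.
have A0 : 0 <= e / (3 * N) * normc h by rewrite mulr_ge0 ?nc_ge0// ltW.
rewrite (le_trans (le_normcD _ _))// lerD//.
  rewrite (le_trans (le_normcD _ _))// lerD//.
    rewrite (le_trans (nc_dot _ _))// ler_pM ?nrm_ge0//.
    rewrite -[G](subrK g0) (le_trans (nrmD _ _))// /N -/g0; lra.
  rewrite normcM (le_trans (ler_wpM2l (nc_ge0 _) (nc_dot _ _)))//.
  rewrite mulrCA [leRHS]mulrC ler_pM ?mulr_ge0 ?nrm_ge0 ?nc_ge0//.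
    by rewrite /N -/g0; lra.
  by rewrite mulrC ler_wpM2r ?nc_ge0.
rewrite (le_trans (nc_dot _ _))// [leRHS]mulrC ler_pM ?nrm_ge0//.
by rewrite /N -/g0; lra.
Qed.

End Dot.
End VectorDerivative.

(** * Functions with holomorphic extensions from real planes *)

Section LineDerivatives.
Variables (R : realType) (m : nat).
Local Notation C := R[i].
Local Notation Cm := 'rV[C]_m.

Definition lder (v : Cm) (G : Cm -> C) (w : Cm) (d : C) :=
  rder (fun x : R => G (w + (x%:C)%C *: v)) 0 d.

Lemma real_dirderivE v G w d : lder v G w d -> real_dirderiv v G w = d.
Proof.
move=> [[_ dRe] [_ dIm]]; rewrite /real_dirderiv !derive1E dRe dIm.
by case: d {dRe dIm}.
Qed.

Lemma rder_near (f g : R -> C) (x r : R) (d : C) : 0 < r ->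
  (forall h, `|h| < r -> f (x + h) = g (x + h)) -> rder f x d -> rder g x d.
Proof.
move=> r0 fg [dR dI]; split.
  by refine (is_derive_near r0 _ dR) => h hr; rewrite fg.
by refine (is_derive_near r0 _ dI) => h hr; rewrite fg.
Qed.

(** On the parameters in [Q], the restriction of [G] to the plane through [w]
    spanned by [v] and [v'] is a separately holomorphic function of the
    conjugates of the parameters.  Two choices of [Q] matter: all complex
    numbers, for antiholomorphic [G], and the real ones, for Gram entries, which
    are holomorphic in one factor and antiholomorphic in the other, so that only
    their restriction to real parameters extends holomorphically. *)
Variant slice (Q : C -> Prop) (G : Cm -> C) (w v v' : Cm) : Prop :=
  Slice (rho M : R) (F Fs Ft : C -> C -> C) of 0 < rho &
    biholomorphic rho M F Fs Ft &
    (forall s t, Q s -> Q t -> normc s < rho -> normc t < rho ->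
      G (w + s *: v + t *: v') = F (s^*)%C (t^*)%C).

Lemma conjc_R (x : R) : ((x%:C)^*)%C = (x%:C)%C :> C.
Proof. by rewrite /= oppr0. Qed.

Lemma conjc_Ri (x : R) : (((x%:C)%C * 'i%C)^*)%C = (x%:C)%C * - 'i%C :> C.
Proof. by apply/eqP; rewrite eq_complex /=; apply/andP; split; apply/eqP; ring. Qed.

Section Derivatives.
Variables (Q : C -> Prop) (G : Cm -> C) (w v v' : Cm).
Hypothesis Qreal : forall x : R, Q (x%:C)%C.
Hypothesis GS : slice Q G w v v'.

(** When the imaginary parameters belong to [Q], multiplying the direction by
    [i] multiplies the derivative by [-i], as [G] is then antiholomorphic. *)
Lemma slice_lder : exists d, lder v G w d /\
  ((forall x : R, Q ((x%:C)%C * 'i%C)) -> lder ('i%C *: v) G w (- 'i%C * d)).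
Proof.
case: GS => rho M F Fs Ft rho0 [Hs Ht _] E /=.
have n0 : normc (0 : C) < rho by rewrite normc0.
exists (Fs 0 0); have F0 := Hs 0 0 n0 n0; split.
  refine (rder_near rho0 _ (cderiv_rder (t := 0) F0)) => h hrho.
  rewrite add0r; have := E (h%:C)%C 0 (Qreal h) (Qreal 0).
  by rewrite nc_real normc0 conjc_R conjc0 scale0r addr0; move=> ->.
move=> Qi; rewrite mulrC; have := cderiv_ray (f := F^~ 0) (t := 0) (c := - 'i%C).
rewrite mul0r => /(_ _ F0) Fi; refine (rder_near rho0 _ Fi) => h hrho.
rewrite add0r; have := E ((h%:C)%C * 'i%C) 0 (Qi h) (Qreal 0).
rewrite normcM nc_real nc_i mulr1 normc0 conjc0 scale0r addr0 scalerA.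
by move=> ->//; rewrite conjc_Ri.
Qed.

(** Along [w + y v'] the first derivative is [Fs 0 y], so this is
    [mixed_derivative]. *)
Lemma slice_lder2 : exists d, lder v' (real_dirderiv v G) w d /\
  ((forall x : R, Q ((x%:C)%C * 'i%C)) ->
    lder ('i%C *: v') (real_dirderiv v G) w (- 'i%C * d)).
Proof.
case: GS => rho M F Fs Ft rho0 B E; have [Hs _ _] := B.
have n0 : normc (0 : C) < rho by rewrite normc0.
have first t : Q t -> normc t < rho ->
    real_dirderiv v G (w + t *: v') = Fs 0 (t^*)%C.
  move=> Qt trho; apply: real_dirderivE.
  have tc : normc (t^*)%C < rho by rewrite nc_conj.
  have F0 := @cderiv_rder R (F^~ (t^*)%C) 0 _ (Hs 0 _ n0 tc).
  refine (rder_near rho0 _ F0) => h hrho; rewrite add0r.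
  have := E (h%:C)%C t (Qreal h) Qt; rewrite nc_real conjc_R => /(_ hrho trho) <-.
  by rewrite addrAC.
have [d [d1 d2]] := mixed_derivative rho0 B.
exists d; split=> [|Qi].
  refine (rder_near rho0 _ d1) => h hrho; rewrite add0r.
  by rewrite first ?conjc_R ?nc_real.
refine (rder_near rho0 _ d2) => h hrho; rewrite add0r scalerA.
by rewrite first ?conjc_Ri// normcM nc_real nc_i mulr1.
Qed.

End Derivatives.

Section Closure.
Variables (Q : C -> Prop) (w v v' : Cm).
Local Notation slice G := (slice Q G w v v').

Lemma biholomorphicS (rho rho' M : R) F Fs Ft : rho' <= rho ->
  @biholomorphic R rho M F Fs Ft -> biholomorphic rho' M F Fs Ft.
Proof.
move=> rr [Hs Ht HM]; split=> s t hs ht; [apply: Hs|apply: Ht|apply: HM];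
  exact: lt_le_trans rr.
Qed.

Lemma slice_cst (c : C) : slice (fun=> c).
Proof.
apply: (@Slice _ _ _ _ _ 1 (normc c)
  (fun _ _ => c) (fun _ _ => 0) (fun _ _ => 0)) => //.
by split=> s t _ _; [exact: cderiv_cst|exact: cderiv_cst|].
Qed.

Lemma sliceD G G' : slice G -> slice G' -> slice (fun z => G z + G' z).
Proof.
move=> [r M F Fs Ft r0 B E] [r' M' F' Fs' Ft' r0' B' E'].
pose rho := Num.min r r'.
have rr : rho <= r by rewrite ge_min lexx.
have rr' : rho <= r' by rewrite ge_min lexx orbT.
have [Hs Ht HM] := biholomorphicS rr B; have [Hs' Ht' HM'] := biholomorphicS rr' B'.
apply: (@Slice _ _ _ _ _ rho (M + M') (fun s t => F s t + F' s t)
  (fun s t => Fs s t + Fs' s t) (fun s t => Ft s t + Ft' s t)).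
- by rewrite lt_min r0.
- split=> s t hs ht; [exact: cderivD (Hs _ _ hs ht) (Hs' _ _ hs ht)
    |exact: cderivD (Ht _ _ hs ht) (Ht' _ _ hs ht)|].
  by rewrite (le_trans (le_normcD _ _))// lerD ?HM ?HM'.
- by move=> s t qs qt hs ht; rewrite E ?E'//; apply: lt_le_trans; eauto.
Qed.

Lemma sliceM G G' : slice G -> slice G' -> slice (fun z => G z * G' z).
Proof.
move=> [r M F Fs Ft r0 B E] [r' M' F' Fs' Ft' r0' B' E'].
pose rho := Num.min r r'.
have rr : rho <= r by rewrite ge_min lexx.
have rr' : rho <= r' by rewrite ge_min lexx orbT.
have [Hs Ht HM] := biholomorphicS rr B; have [Hs' Ht' HM'] := biholomorphicS rr' B'.
apply: (@Slice _ _ _ _ _ rho (M * M') (fun s t => F s t * F' s t)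
  (fun s t => Fs s t * F' s t + F s t * Fs' s t)
  (fun s t => Ft s t * F' s t + F s t * Ft' s t)).
- by rewrite lt_min r0.
- split=> s t hs ht; [exact: cderivM (Hs _ _ hs ht) (Hs' _ _ hs ht)
    |exact: cderivM (Ht _ _ hs ht) (Ht' _ _ hs ht)|].
  by rewrite normcM ler_pM ?nc_ge0 ?HM ?HM'.
- by move=> s t qs qt hs ht; rewrite E ?E'//; apply: lt_le_trans; eauto.
Qed.

Lemma slice_conj G : (forall s, Q s -> (s^*)%C = s) -> slice G ->
  slice (fun z => ((G z)^*)%C).
Proof.
move=> QE [r M F Fs Ft r0 [Hs Ht HM] E].
apply: (@Slice _ _ _ _ _ r M (fun s t => ((F (s^*)%C (t^*)%C)^*)%C)
  (fun s t => ((Fs (s^*)%C (t^*)%C)^*)%C)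
  (fun s t => ((Ft (s^*)%C (t^*)%C)^*)%C)) => //.
  split=> s t; rewrite -(nc_conj s) -(nc_conj t) => hs ht.
  - exact: (cderiv_conj (Hs _ _ hs ht)).
  - exact: (cderiv_conj (Ht _ _ hs ht)).
  - by rewrite nc_conj HM.
by move=> s t qs qt hs ht; rewrite E// !(QE s qs) !(QE t qt).
Qed.

Lemma slice_sum (I : Type) (r : seq I) (P : pred I) (G : I -> Cm -> C) :
  (forall i, slice (G i)) -> slice (fun z => \sum_(i <- r | P i) G i z).
Proof.
move=> hG; elim: r => [|i r IH].
  have -> : (fun z => \sum_(i <- [::] | P i) G i z) = fun=> 0.
    by apply/funext => z; rewrite big_nil.
  exact: slice_cst.
have -> : (fun z => \sum_(j <- i :: r | P j) G j z) =
    fun z => (if P i then G i z else 0) + \sum_(j <- r | P j) G j z.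
  by apply/funext => z; rewrite big_cons; case: (P i); rewrite ?add0r.
by apply: sliceD IH; case: (P i); [exact: hG|exact: slice_cst].
Qed.

Lemma slice_prod (I : Type) (r : seq I) (P : pred I) (G : I -> Cm -> C) :
  (forall i, slice (G i)) -> slice (fun z => \prod_(i <- r | P i) G i z).
Proof.
move=> hG; elim: r => [|i r IH].
  have -> : (fun z => \prod_(i <- [::] | P i) G i z) = fun=> 1.
    by apply/funext => z; rewrite big_nil.
  exact: slice_cst.
have -> : (fun z => \prod_(j <- i :: r | P j) G j z) =
    fun z => (if P i then G i z else 1) * \prod_(j <- r | P j) G j z.
  by apply/funext => z; rewrite big_cons; case: (P i); rewrite ?mul1r.
by apply: sliceM IH; case: (P i); [exact: hG|exact: slice_cst].
Qed.

Lemma slice_det n (A : Cm -> 'M[C]_n) : (forall i j, slice (fun z => A z i j)) ->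
  slice (fun z => \det (A z)).
Proof.
move=> hA; rewrite /determinant; apply: slice_sum => s.
by apply: sliceM; [exact: slice_cst|apply: slice_prod => i; exact: hA].
Qed.

End Closure.

End LineDerivatives.

(** * Complex-valued functions of a real variable *)

Section RealCurveCalculus.
Variable R : realType.
Local Notation C := R[i].
Implicit Types (f g : R -> C) (d : C).

Lemma rder_uniq f (t : R) d d' : rder f t d -> rder f t d' -> d = d'.
Proof.
move=> [[_ r1] [_ i1]] [[_ r2] [_ i2]]; apply/eqP.
by rewrite eq_complex -r1 -r2 -i1 -i2 !eqxx.
Qed.

Lemma rder_cst (c : C) (t : R) : rder (fun=> c) t 0.
Proof. by split; exact: is_derive_cst. Qed.

Lemma rderD f g (t : R) d e : rder f t d -> rder g t e ->
  rder (fun x => f x + g x) t (d + e).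
Proof.
move=> [r1 i1] [r2 i2]; split.
  rewrite cReD; under eq_fun do rewrite cReD; exact: is_deriveD.
rewrite cImD; under eq_fun do rewrite cImD; exact: is_deriveD.
Qed.

Lemma rderM f g (t : R) d e : rder f t d -> rder g t e ->
  rder (fun x => f x * g x) t (d * g t + f t * e).
Proof.
move=> [r1 i1] [r2 i2]; split.
  under eq_fun do rewrite cReM.
  have h := is_deriveB (is_deriveM r1 r2) (is_deriveM i1 i2).
  rewrite [X in is_derive _ _ _ X](_ : _ = complex.Re (f t) * complex.Re e +
    complex.Re (g t) * complex.Re d - (complex.Im (f t) * complex.Im e +
    complex.Im (g t) * complex.Im d)); last by rewrite cReD !cReM; ring.
  exact: h.
under eq_fun do rewrite cImM.
have h := is_deriveD (is_deriveM r1 i2) (is_deriveM i1 r2).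
rewrite [X in is_derive _ _ _ X](_ : _ = complex.Re (f t) * complex.Im e +
  complex.Im (g t) * complex.Re d + (complex.Im (f t) * complex.Re e +
  complex.Re (g t) * complex.Im d)); last by rewrite cImD !cImM; ring.
exact: h.
Qed.

Lemma rder_conj f (t : R) d : rder f t d -> rder (fun x => (f x)^*%C) t (d^*)%C.
Proof.
move=> [r1 i1]; split.
  have -> : (fun x => complex.Re (f x)^*%C) = fun x => complex.Re (f x).
    by apply/funext => x; case: (f x).
  by case: d r1 {i1}.
have -> : (fun x => complex.Im (f x)^*%C) = - (fun x => complex.Im (f x)).
  by apply/funext => x; rewrite fctE; case: (f x).
by case: d {r1} i1 => a b /= i1; exact: is_deriveN.
Qed.

(** Only the existence of the derivative is recorded; its value follows in
    [rder_quot] from the product rule and uniqueness. *)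
Lemma rder_inv f (t : R) d : f t != 0 -> rder f t d ->
  exists d', rder (fun x => (f x)^-1) t d'.
Proof.
move=> ft0 [[dr _] [di _]].
pose n x := complex.Re (f x) ^+ 2 + complex.Im (f x) ^+ 2.
have nE : n = (fun x => complex.Re (f x)) * (fun x => complex.Re (f x)) +
    (fun x => complex.Im (f x)) * (fun x => complex.Im (f x)) by [].
have n0 : n t != 0.
  apply: contra ft0; rewrite /n paddr_eq0 ?sqr_ge0// !sqrf_eq0.
  move=> /andP[/eqP r0 /eqP i0].
  by rewrite eq_complex r0 i0 !eqxx.
have dn : derivable n t 1.
  by rewrite nE; exact: (derivableD (derivableM dr dr) (derivableM di di)).
have dV := derivableV n0 dn.
have dR := derivableM dr dV.
have dI := derivableN (derivableM di dV).
exists ('D_1 ((fun x => complex.Re (f x)) * (fun x => (n x)^-1)) t +i*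
  'D_1 (- ((fun x => complex.Im (f x)) * (fun x => (n x)^-1))) t)%C.
split => /=.
  have -> : (fun x => complex.Re (f x)^-1) =
     (fun x => complex.Re (f x)) * (fun x => (n x)^-1).
    apply/funext => x; rewrite -[RHS]/(complex.Re (f x) * (n x)^-1) /n.
    by case: (f x).
  exact: (DeriveDef dR erefl).
have -> : (fun x => complex.Im (f x)^-1) =
   - ((fun x => complex.Im (f x)) * (fun x => (n x)^-1)).
  apply/funext => x; rewrite -[RHS]/(- (complex.Im (f x) * (n x)^-1)) /n.
  by case: (f x).
exact: (DeriveDef dI erefl).
Qed.

Lemma rder_quot f g (t r : R) d e : 0 < r -> (forall x, `|x| < r -> g (t + x) != 0) ->
  rder f t d -> rder g t e ->
  rder (fun x => f x / g x) t ((d - f t / g t * e) / g t).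
Proof.
move=> r0 g0 fd ge; have gt0 : g t != 0 by have := g0 0; rewrite normr0 addr0; exact.
have [e' gi] := rder_inv gt0 ge.
have q := rderM fd gi.
have qg : rder f t ((d * (g t)^-1 + f t * e') * g t + f t / g t * e).
  by refine (rder_near r0 _ (rderM q ge)) => x /g0 gx; rewrite divfK.
have dE := rder_uniq qg fd.
suff -> : (d - f t / g t * e) / g t = d * (g t)^-1 + f t * e' by exact: q.
have /= {}dE := congr1 (fun x => (x - f t / g t * e) / g t) dE.
by rewrite -dE addrK mulfK.
Qed.

End RealCurveCalculus.

(** * Derivatives along lines and Wirtinger derivatives *)

Section LineCalculus.
Variables (R : realType) (m : nat).
Local Notation C := R[i].
Local Notation Cm := 'rV[C]_m.
Implicit Types (v w : Cm) (f g : Cm -> C) (W : set Cm).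

Lemma open_ray W w v : open W -> W w ->
  exists2 r : R, 0 < r & forall x : R, `|x| < r -> W (w + (x%:C)%C *: v).
Proof.
move=> oW Ww; have /nbhs_ballP[e /= e0 he] : nbhs w W by exact: open_nbhs_nbhs.
have [e' e'0 eE] : exists2 e' : R, 0 < e' & e = (e'%:C)%C.
  by move: e0; rewrite ltcE/=; case: (e) => a b /= /andP[/eqP -> a0]; exists a.
exists (e' / (nrm v + 1)).
  by rewrite divr_gt0// ltr_wpDl ?nrm_ge0.
move=> x; rewrite ltr_pdivlMr ?ltr_wpDl ?nrm_ge0// => hx.
apply: he; rewrite -ball_normE /ball_ /= opprD addNKr normrN nrmE eE ltcR nrmZ nc_real.
by apply: le_lt_trans hx; rewrite ler_wpM2l// lerDl.
Qed.

Lemma lder_open W f g w v d : open W -> W w -> (forall z, W z -> f z = g z) ->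
  lder v f w d -> lder v g w d.
Proof.
move=> oW Ww fg; have [r r0 hr] := open_ray v oW Ww.
by apply: (rder_near r0) => h hh; rewrite add0r fg//; exact: hr.
Qed.

Lemma lderD f g w v d e : lder v f w d -> lder v g w e ->
  lder v (fun z => f z + g z) w (d + e).
Proof. exact: rderD. Qed.

Lemma lderM f g w v d e : lder v f w d -> lder v g w e ->
  lder v (fun z => f z * g z) w (d * g w + f w * e).
Proof. by move=> fd ge; have := rderM fd ge; rewrite scale0r addr0. Qed.

Lemma lderZ f w v (c d : C) : lder v f w d -> lder v (fun z => c * f z) w (c * d).
Proof. by move=> /(rderM (rder_cst c 0)); rewrite mul0r add0r. Qed.

Lemma lder_quot W f g w v d e : open W -> W w -> (forall z, W z -> g z != 0) ->
  lder v f w d -> lder v g w e ->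
  lder v (fun z => f z / g z) w ((d - f w / g w * e) / g w).
Proof.
move=> oW Ww g0 fd ge; have [r r0 hr] := open_ray v oW Ww.
have := rder_quot r0 _ fd ge; rewrite scale0r addr0; apply => x xr.
by rewrite add0r g0//; exact: hr.
Qed.

Lemma lder_conj f w v d : lder v f w d -> lder v (fun z => ((f z)^*)%C) w (d^*)%C.
Proof. exact: rder_conj. Qed.

(** The Wirtinger operators are defined through derivatives along real lines, so
    the existence of those up to order two makes a mixed Wirtinger derivative
    meaningful and additive. *)
Definition twice_lder W f := forall z, W z -> forall v,
  (exists d, lder v f z d) /\ forall v', exists d, lder v' (real_dirderiv v f) z d.

Lemma lder_wirtinger_bar W f z v j : twice_lder W f -> W z ->
  exists d, lder v (wirtinger_bar j f) z d.
Proof.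
move=> tf Wz; have [_ /(_ v)[d hd]] := tf z Wz (delta_mx 0 j).
have [_ /(_ v)[e he]] := tf z Wz ('i%C *: delta_mx 0 j).
exists (2^-1 * (d + 'i%C * e)).
have -> : wirtinger_bar j f = fun w => 2^-1 * (real_dirderiv (delta_mx 0 j) f w +
    'i%C * real_dirderiv ('i%C *: delta_mx 0 j) f w).
  by apply/funext => w; rewrite /wirtinger_bar mulrC.
exact: lderZ (lderD hd (lderZ 'i%C he)).
Qed.

Lemma real_dirderivD W f g h z v : open W -> W z ->
  (forall z, W z -> h z = f z + g z) ->
  (exists d, lder v f z d) -> (exists d, lder v g z d) ->
  real_dirderiv v h z = real_dirderiv v f z + real_dirderiv v g z.
Proof.
move=> oW Wz hfg [d fd] [e ge]; rewrite (real_dirderivE fd) (real_dirderivE ge).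
apply: real_dirderivE; apply: lder_open oW Wz _ (lderD fd ge) => y Wy.
by rewrite hfg.
Qed.

(** The derivatives of the summands have to exist: the operators are total and
    take default values where the limits do not exist. *)
Lemma wirtinger2D W f g h z i j : open W -> W z ->
  (forall z, W z -> h z = f z + g z) -> twice_lder W f -> twice_lder W g ->
  wirtinger i (wirtinger_bar j h) z =
  wirtinger i (wirtinger_bar j f) z + wirtinger i (wirtinger_bar j g) z.
Proof.
move=> oW Wz hfg tf tg.
have wb y : W y -> wirtinger_bar j h y = wirtinger_bar j f y + wirtinger_bar j g y.
  move=> Wy; have D v := real_dirderivD oW Wy hfg (tf _ Wy v).1 (tg _ Wy v).1.
  by rewrite /wirtinger_bar !D mulrDr addrACA mulrDl.
have D v := real_dirderivD (v := v) oW Wz wb (lder_wirtinger_bar v j tf Wz)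
  (lder_wirtinger_bar v j tg Wz).
rewrite /wirtinger (D (delta_mx 0 i)) (D ('i%C *: delta_mx 0 i)).
by rewrite mulrDr opprD addrACA mulrDl.
Qed.

Lemma lder_real (g : Cm -> R) z v (k : R) :
  is_derive (0 : R) 1 (fun x => g (z + (x%:C)%C *: v)) k ->
  lder v (fun y => ((g y)%:C)%C) z (k%:C)%C.
Proof. by move=> gk; split => //=; exact: is_derive_cst. Qed.

Lemma ln_lder h z v d : 0 < complex.Re (h z) -> lder v h z d ->
  lder v (fun y => ((ln (complex.Re (h y)))%:C)%C) z
    ((complex.Re d / complex.Re (h z))%:C)%C.
Proof.
move=> hz [hd _]; apply: (lder_real (g := fun y => ln (complex.Re (h y)))).
have hz' : 0 < complex.Re (h (z + ((0 : R)%:C)%C *: v)) by rewrite scale0r addr0.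
have := is_derive1_comp (is_derive1_ln hz') hd.
rewrite scale0r addr0 mulrC; exact.
Qed.

Lemma twice_lder_ln W h (Q : C -> Prop) : open W -> (forall x : R, Q (x%:C)%C) ->
  (forall z, W z -> 0 < complex.Re (h z)) ->
  (forall z v v', W z -> slice Q h z v v') ->
  twice_lder W (fun y => ((ln (complex.Re (h y)))%:C)%C).
Proof.
move=> oW QR hpos hs z Wz v; split.
  have [d [hd _]] := slice_lder QR (hs z v v Wz).
  by eexists; exact: ln_lder (hpos _ Wz) hd.
move=> v'.
have [d [[hd _] _]] := slice_lder2 QR (hs z v v' Wz).
have [e [[he _] _]] := slice_lder QR (hs z v' v' Wz).
have E y : W y -> ((complex.Re (real_dirderiv v h y) / complex.Re (h y))%:C)%C =
    real_dirderiv v (fun y => ((ln (complex.Re (h y)))%:C)%C) y.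
  move=> Wy; have [k [hk _]] := slice_lder QR (hs y v v Wy).
  by rewrite (real_dirderivE (ln_lder (hpos _ Wy) hk)) (real_dirderivE hk).
have h0 : complex.Re (h (z + ((0 : R)%:C)%C *: v')) != 0.
  by rewrite scale0r addr0 gt_eqF// hpos.
have K := lder_real (g := fun y => complex.Re (real_dirderiv v h y) / complex.Re (h y))
  (is_deriveM hd (is_deriveV h0 he)).
by eexists; exact: lder_open oW Wz E K.
Qed.

End LineCalculus.

(** * The logarithm of the modulus of an antiholomorphic function *)

Section LogModulus.
Variables (R : realType) (m : nat).
Local Notation C := R[i].
Local Notation Cm := 'rV[C]_m.

Lemma sqmod_gt0 (x : C) : x != 0 -> 0 < complex.Re (x * (x^*)%C).
Proof.
case: x => a b; rewrite eq_complex /= mulrN opprK => ab.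
by rewrite lt_def addr_ge0 -?expr2 ?sqr_ge0// andbT paddr_eq0 ?sqr_ge0// !sqrf_eq0.
Qed.

Lemma Re_conj_fixed (x : C) : (x^*)%C = x -> ((complex.Re x)%:C)%C = x.
Proof.
case: x => a b /= /eqP; rewrite eq_complex /= eqxx /= => /eqP bN.
have -> : b = 0 by lra.
by [].
Qed.

Lemma Re_div_fixed (x y : C) : (x^*)%C = x -> (y^*)%C = y ->
  ((complex.Re x / complex.Re y)%:C)%C = x / y.
Proof.
by move=> xr yr; rewrite rmorphM fmorphV /= !Re_conj_fixed.
Qed.

Lemma log_deriv_field (F : numFieldType) (k p q a b : F) : k * k = -1 ->
  a != 0 -> b != 0 ->
  ((p * b + a * q) / (a * b) + k * ((- k * p * b + a * (k * q)) / (a * b))) / 2 = p / a.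
Proof.
move=> kk a0 b0.
have -> : k * ((- k * p * b + a * (k * q)) / (a * b)) =
  k * k * (a * q - p * b) / (a * b) by field; rewrite a0 b0.
by rewrite kk; field; rewrite a0 b0.
Qed.

(** Here [p] and [- i p] are the derivatives of [a] along two directions [e] and
    [i e].  The two quotients are then those of [log |a|^2] along [e] and
    [i e], and the left-hand side is its derivative with respect to the
    conjugate coordinate. *)
Lemma log_deriv_identity (p a : C) : a != 0 ->
  (((complex.Re (p * (a^*)%C + a * (p^*)%C) / complex.Re (a * (a^*)%C))%:C)%C +
   'i%C * ((complex.Re (- 'i%C * p * (a^*)%C + a * ((- 'i%C * p)^*)%C) /
            complex.Re (a * (a^*)%C))%:C)%C) / 2 = p / a.
Proof.
move=> a0.
have fix_D (x y : C) : ((x * (y^*)%C + y * (x^*)%C)^*)%C = x * (y^*)%C + y * (x^*)%C.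
  by rewrite rmorphD !rmorphM /= !conjcK addrC ![(_^*)%C * _]mulrC.
have aaC : ((a * (a^*)%C)^*)%C = a * (a^*)%C by rewrite rmorphM /= conjcK mulrC.
rewrite !Re_div_fixed//.
have -> : ((- 'i%C * p)^*)%C = 'i%C * (p^*)%C :> C.
  by rewrite rmorphM /=; congr (_ * _); rewrite oppr0 opprK.
by apply: log_deriv_field; rewrite ?conjc_eq0// -expr2 sqr_i.
Qed.

(** The conjugate derivative [q] of [log |a|^2] is the quotient of two
    antiholomorphic functions.  Its derivative along [i e_i] is therefore [-i]
    times that along [e_i], which makes its derivative with respect to [w_i]
    vanish. *)
Lemma wirtinger2_log_modulus (W : set Cm) (a : Cm -> C) z i j : open W -> W z ->
  (forall y, W y -> a y != 0) ->
  (forall y v v', W y -> slice (fun=> True) a y v v') ->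
  wirtinger i (wirtinger_bar j
    (fun y => ((ln (complex.Re (a y * ((a y)^*)%C)))%:C)%C)) z = 0.
Proof.
move=> oW Wz a0 sa.
pose h y := a y * ((a y)^*)%C.
have lh y v p : lder v a y p -> lder v h y (p * ((a y)^*)%C + a y * (p^*)%C).
  by move=> hp; exact: lderM hp (lder_conj hp).
have q y : W y -> real_dirderiv (delta_mx 0 j) a y / a y =
    wirtinger_bar j (fun y => ((ln (complex.Re (h y)))%:C)%C) y.
  move=> Wy; have [p [hp /(_ (fun=> I)) hip]] :=
    slice_lder (fun=> I) (sa y (delta_mx 0 j) 0 Wy).
  have hpos := sqmod_gt0 (a0 y Wy).
  rewrite /wirtinger_bar (real_dirderivE (ln_lder hpos (lh _ _ _ hp))).
  rewrite (real_dirderivE (ln_lder hpos (lh _ _ _ hip))) (real_dirderivE hp).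
  by rewrite log_deriv_identity// a0.
have [d [hd /(_ (fun=> I)) hid]] :=
  slice_lder2 (fun=> I) (sa z (delta_mx 0 j) (delta_mx 0 i) Wz).
have [e [he /(_ (fun=> I)) hie]] := slice_lder (fun=> I) (sa z (delta_mx 0 i) 0 Wz).
have k1 := lder_open oW Wz q (lder_quot oW Wz a0 hd he).
have k2 := lder_open oW Wz q (lder_quot oW Wz a0 hid hie).
rewrite /wirtinger (real_dirderivE k1) (real_dirderivE k2).
set b := real_dirderiv _ _ _ / _.
have -> : (- 'i%C * d - b * (- 'i%C * e)) / a z = - 'i%C * ((d - b * e) / a z).
  by rewrite mulrCA -mulrBr mulrA.
by rewrite mulrA mulrN -expr2 sqr_i opprK mul1r subrr mul0r.
Qed.

End LogModulus.

(** * Planar extensions of antiholomorphic maps *)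

Section AntiholomorphicSlices.
Variables (R : realType) (m : nat).
Local Notation C := R[i].
Local Notation Cm := 'rV[C]_m.
Implicit Types (w v : Cm) (W : set Cm).

Lemma conjvK : involutive (@conjv R m).
Proof. by move=> z; apply/matrixP => i j; rewrite !mxE conjCK. Qed.

Lemma conjvD v w : conjv (v + w) = conjv v + conjv w.
Proof. by rewrite /conjv map_mxD. Qed.

Lemma conjvZ (s : C) v : conjv (s *: v) = (s^*)%C *: conjv v.
Proof. by apply/matrixP => i j; rewrite !mxE rmorphM. Qed.

Lemma nrm_conjv v : nrm (conjv v) = nrm v.
Proof.
rewrite /nrm; congr complex.Re; rewrite -[LHS]/(mx_norm _) -[RHS]/(mx_norm _) !mx_normE.
congr (_%:nngnum); apply: eq_bigr => ij _; apply/val_inj => /=.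
by rewrite mxE norm_conjC.
Qed.

Lemma antiholo_local (V : normedModType C) (S : Cm -> V) W w v v' :
  open W -> W w -> antiholomorphic_on W S ->
  exists rho N : R, 0 < rho /\ forall s t, normc s < rho -> normc t < rho ->
    let p := conjv w + s *: v + t *: v' in
    differentiable (S \o @conjv R m) p /\ nrm (S (conjv p)) <= N.
Proof.
move=> oW Ww hol.
have hS : differentiable (S \o @conjv R m) (conjv w) by apply: hol; rewrite /= conjvK.
have := differentiable_continuous hS; move=> /cvgrPdist_le /(_ 1 ltr01) /nbhs_ballP[e1 /= e10 h1].
have /nbhs_ballP[e2 /= e20 h2] : nbhs w W by exact: open_nbhs_nbhs.
have realE (e : C) : 0 < e -> exists2 e' : R, 0 < e' & e = (e'%:C)%C.
  by rewrite ltcE/=; case: e => a b /= /andP[/eqP -> a0]; exists a.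
have [e1' e1'0 E1] := realE _ e10; have [e2' e2'0 E2] := realE _ e20.
pose N := nrm v + nrm v' + 1.
have N0 : 0 < N by rewrite /N ltr_wpDl// addr_ge0 ?nrm_ge0.
pose rho := Num.min e1' e2' / N.
have m0 : 0 < Num.min e1' e2' by rewrite lt_min e1'0.
exists rho, (nrm (S w) + 1); split; first by rewrite divr_gt0.
move=> s t hs ht /=; set p := _ + t *: v'.
have dp : nrm (s *: v + t *: v') < Num.min e1' e2'.
  rewrite (le_lt_trans (nrmD _ _))// !nrmZ.
  rewrite (@le_lt_trans _ _ (rho * (nrm v + nrm v')))//.
    by rewrite mulrDr lerD// ler_wpM2r ?nrm_ge0// ltW.
  by rewrite /rho mulrAC ltr_pdivrMr// ltr_pM2l// /N ltrDl.
move: dp; rewrite lt_min => /andP[dp1 dp2].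
split.
  apply: hol; rewrite /=; apply: h2; rewrite -ball_normE /ball_ /= E2 nrmE ltcR.
  rewrite -nrm_conjv conjvD -scaleN1r conjvZ conjvK rmorphN1 scaleN1r.
  by rewrite /p -addrA opprD addNKr -scaleN1r nrmZ normcN normc1 mul1r.
have := h1 p; rewrite -ball_normE /ball_ /= E1 (nrmE (conjv w - p)) ltcR => {}h1.
have : nrm (conjv w - p) < e1'.
  by rewrite /p -addrA opprD addNKr -scaleN1r nrmZ normcN normc1 mul1r.
move=> /h1; rewrite conjvK nrmE -[1 : C]/((1 : R)%:C)%C lecR => h.
rewrite -[S (conjv p)](subrK (S w)) (le_trans (nrmD _ _))// addrC lerD2l.
by rewrite -opprB -scaleN1r nrmZ normcN normc1 mul1r.
Qed.

Lemma slice_entry (k l : nat) (A : Cm -> 'M[C]_(k, l)) W w v v' (Q : C -> Prop) i j :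
  open W -> W w -> antiholomorphic_on W A -> slice Q (fun z => A z i j) w v v'.
Proof.
move=> oW Ww hA.
have [rho [N [rho0 hrho]]] := antiholo_local (conjv v) (conjv v') oW Ww hA.
pose p s t := conjv w + s *: conjv v + t *: conjv v'.
pose A0 := A \o @conjv R m.
apply: (@Slice _ _ _ _ _ _ _ rho N (fun s t => A0 (p s t) i j)
  (fun s t => 'D_(conjv v) A0 (p s t) i j)
  (fun s t => 'D_(conjv v') A0 (p s t) i j)) => //.
  split=> s t hs ht; have [dA nA] := hrho s t hs ht.
  - apply: (@vderiv_entry _ _ _ (fun x => A0 (p x t)) s ('D_(conjv v) A0 (p s t))).
    have E x : p x t = conjv w + t *: conjv v' + x *: conjv v by exact: addrAC.
    rewrite E; under eq_fun do rewrite E.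
    by apply: derivable_vderiv; rewrite -E.
  - exact: (vderiv_entry i j (derivable_vderiv dA)).
  - exact: le_trans (nc_entry _ _ _) nA.
move=> s t _ _ _ _; rewrite /A0 /p /= !conjvD !conjvZ !conjvK.
by rewrite -!conjE !conjCK.
Qed.

(** The extension is [(s, t) |-> <S (conj q), S' (conj q')>], where
    [q = conj w + s (conj v) + t (conj v')] and [q'] is the same with
    conjugated parameters.  It is holomorphic in [s] and in [t] because the
    inner product is conjugate-linear on the right, and at real parameters
    [q = q'] is the conjugate of a point of the plane. *)
Lemma slice_gram (Omega : set Cm) (H : analyticHilbertModule Omega)
    (S S' : Cm -> H) W w v v' : open W -> W w ->
  antiholomorphic_on W S -> antiholomorphic_on W S' ->
  slice (fun x => (x^*)%C = x) (fun z => ahm_dot H (S z) (S' z)) w v v'.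
Proof.
move=> oW Ww hS hS'.
have [r1 [N1 [r10 h1]]] := antiholo_local (conjv v) (conjv v') oW Ww hS.
have [r2 [N2 [r20 h2]]] := antiholo_local (conjv v) (conjv v') oW Ww hS'.
pose rho := Num.min r1 r2.
have l1 x : x < rho -> x < r1 by move=> hx; rewrite (lt_le_trans hx)// ge_min lexx.
have l2 x : x < rho -> x < r2 by move=> hx; rewrite (lt_le_trans hx)// ge_min lexx orbT.
pose p s t := conjv w + s *: conjv v + t *: conjv v'.
pose S0 := S \o @conjv R m; pose S0' := S' \o @conjv R m.
pose dot := ahm_dot H.
have hd s t : normc s < rho -> normc t < rho ->
    (differentiable S0 (p s t) /\ nrm (S0 (p s t)) <= N1) /\
    (differentiable S0' (p (s^*)%C (t^*)%C) /\ nrm (S0' (p (s^*)%C (t^*)%C)) <= N2).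
  move=> hs ht; split; first by apply: h1; exact: l1.
  by apply: h2; rewrite nc_conj; exact: l2.
apply: (@Slice _ _ _ _ _ _ _ rho (N1 * N2)
  (fun s t => dot (S0 (p s t)) (S0' (p (s^*)%C (t^*)%C)))
  (fun s t => dot ('D_(conjv v) S0 (p s t)) (S0' (p (s^*)%C (t^*)%C)) +
              dot (S0 (p s t)) ('D_(conjv v) S0' (p (s^*)%C (t^*)%C)))
  (fun s t => dot ('D_(conjv v') S0 (p s t)) (S0' (p (s^*)%C (t^*)%C)) +
              dot (S0 (p s t)) ('D_(conjv v') S0' (p (s^*)%C (t^*)%C)))).
- by rewrite lt_min r10.
- split=> s t hs ht; have [[dS nS] [dS' nS']] := hd s t hs ht.
  + have E x y : p x y = conjv w + y *: conjv v' + x *: conjv v by exact: addrAC.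
    apply: (@vderiv_dot _ _ _ H (fun x => S0 (p x t)) (fun x => S0' (p x (t^*)%C))).
      rewrite E; under eq_fun do rewrite E.
      by apply: derivable_vderiv; rewrite -E.
    rewrite E; under eq_fun do rewrite E.
    by apply: derivable_vderiv; rewrite -E.
  + apply: (@vderiv_dot _ _ _ H (fun x => S0 (p s x)) (fun x => S0' (p (s^*)%C x))).
      exact: (@derivable_vderiv _ _ _ S0 (conjv w + s *: conjv v) (conjv v') t dS).
    exact: (@derivable_vderiv _ _ _ S0' (conjv w + (s^*)%C *: conjv v)
      (conjv v') (t^*)%C dS').
  + by rewrite (le_trans (nc_dot _ _))// ler_pM ?nrm_ge0.
move=> s t sR tR _ _; rewrite /S0 /S0' /p /= !conjvD !conjvZ !conjvK.
by rewrite -!conjE !conjCK !conjE sR tR.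
Qed.

End AntiholomorphicSlices.

(** * Gram matrices *)

Section Gram.
Variables (R : realType) (m : nat) (Omega : set 'rV[R[i]]_m).
Variable H : analyticHilbertModule Omega.
Local Notation C := R[i].
Local Notation dot := (ahm_dot H).

Lemma dot_conj (x y : H) : (dot x y)^* = dot y x.
Proof. by rewrite [RHS]hermC /= expr0 mul1r. Qed.

Lemma dot_sum n (s t : 'I_n -> H) (a b : 'I_n -> C) :
  dot (\sum_i a i *: s i) (\sum_i b i *: t i) =
  \sum_i \sum_j a i * dot (s i) (t j) * (b j)^*.
Proof.
rewrite linear_sumlz; apply: eq_bigr => i _.
rewrite linearZl_LR linear_sumr /GRing.scale /= mulr_sumr; apply: eq_bigr => j _.
by rewrite linearZr_LR /= mulrCA mulrC.
Qed.

(** In an orthonormal basis of eigenvectors the Gram matrix is diagonal, with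
    entries the squared norms of nontrivial combinations of the [s i]. *)
Lemma gram_det_gt0 n (s : 'I_n -> H) :
  (forall c : 'I_n -> C, \sum_i c i *: s i = 0 -> forall i, c i = 0) ->
  0 < \det (\matrix_(i, j) dot (s i) (s j)).
Proof.
move=> free_s; set A := \matrix_(i, j) _.
have /hermitian_normalmx/orthomx_spectralP AE : A \is hermsymmx.
  apply/is_hermitianmxP; rewrite expr0 scale1r; apply/matrixP => i j.
  by rewrite !mxE dot_conj.
set P := spectralmx A in AE; set d := spectral_diag A in AE.
have Pu : P \in unitmx by exact: spectral_unit.
have dE : diag_mx d = P *m A *m map_mx Num.conj P^T.
  rewrite -(invmx_unitary (spectral_unitarymx A)) -/P AE.
  by rewrite !mulmxA mulmxV// mul1mx mulmxK.
rewrite AE !det_mulmx det_inv mulrAC mulVf ?mul1r; last by rewrite -unitfE -unitmxE.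
rewrite det_diag; apply: prodr_gt0 => i _.
have -> : d 0 i = dot (\sum_j P i j *: s j) (\sum_j P i j *: s j).
  have /matrixP/(_ i i) := dE; rewrite !mxE eqxx mulr1n => ->.
  rewrite dot_sum exchange_big; apply: eq_bigr => k _ /=.
  by rewrite !mxE mulr_suml; apply: eq_bigr => j _; rewrite !mxE.
rewrite lt_def dnorm_ge0 andbT -ahm_dotE expf_eq0 /= normr_eq0.
apply/eqP => /free_s Pi0.
have : row i P = 0 by apply/rowP => j; rewrite !mxE Pi0.
move=> /(congr1 (mulmx^~ (invmx P))); rewrite -row_mul mulmxV// mul0mx.
by move=> /rowP/(_ i)/eqP; rewrite !mxE eqxx oner_eq0.
Qed.

Lemma slice_gram_det n (s : 'I_n -> 'rV[C]_m -> H) W w v v' :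
  open W -> W w ->
  (forall i, antiholomorphic_on W (s i)) ->
  slice (fun x => (x^*)%C = x)
    (fun z => \det (\matrix_(i, j) dot (s i z) (s j z))) w v v'.
Proof.
move=> oW Ww hs; apply: slice_det => i j.
have -> : (fun z => (\matrix_(i, j) dot (s i z) (s j z)) i j) =
  fun z => dot (s i z) (s j z) by apply/funext => z; rewrite mxE.
exact: slice_gram oW Ww (hs i) (hs j).
Qed.

End Gram.

(** * Curvature of determinant bundles *)

Section Main.
Variables (R : realType) (m : nat) (Omega : set 'rV[R[i]]_m).
Variables (H H' : analyticHilbertModule Omega).
Local Notation C := R[i].
Local Notation Cm := 'rV[C]_m.

Lemma antiholomorphicS (V : normedModType C) (U W : set Cm) (f : Cm -> V) :
  W `<=` U -> antiholomorphic_on U f -> antiholomorphic_on W f.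
Proof. by move=> WU hf z Wz; apply: hf; exact: WU. Qed.

(** The two frames have the same number of elements because the transition
    matrix is invertible, which makes [det A] meaningful. *)
Lemma curvature_det_equiv (W : set Cm) (E : framedBundle H) (E' : framedBundle H') :
  open W ->
  (forall i, antiholomorphic_on W (fb_frame (f := E) i)) ->
  (forall i, antiholomorphic_on W (fb_frame (f := E') i)) ->
  (forall z, W z -> forall c : 'I_(fb_rank E') -> C,
     \sum_i c i *: fb_frame i z = 0 -> forall i, c i = 0) ->
  bundle_equiv_on W E E' ->
  forall z, W z -> forall u v,
    curvature (det_metric E) z u v = curvature (det_metric E') z u v.
Proof.
case: E E' => b n s [b' n' s'] oW hs hs' free_s' [phi [A]].
rewrite /= in A *; move=> [isom hA invA frameA] z Wz u v.
rewrite /= in hs hs' free_s' A isom hA invA frameA *.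
have nn' : n = n'.
  have [B [AB BA]] := invA z Wz.
  by apply/eqP; rewrite eqn_leq (mulmx1_min AB) (mulmx1_min BA).
subst n'.
pose h := @det_metric R m Omega H (FramedBundle b s).
pose h' := @det_metric R m Omega H' (FramedBundle b' s').
pose a y := \det (A y).
have a0 y : W y -> a y != 0.
  move=> /invA[B [AB _]]; have := congr1 determinant AB.
  rewrite det_mulmx det1 => ab1; apply: contraTneq (oner_neq0 C) => ay0.
  by rewrite -ab1 -/(a y) ay0 mul0r eqxx.
have hpos' y : W y -> 0 < h' y by move=> Wy; exact: gram_det_gt0 (free_s' y Wy).
(* The isometry turns the Gram matrix [G] into [A G' A^*]. *)
have hE y : W y -> h y = a y * ((a y)^*)%C * h' y.
  move=> Wy; have [_ _ dotE] := isom y Wy.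
  have in_fib i : fibre (FramedBundle b s) y (s i y).
    exists (fun j => (j == i)%:R) => //=.
    by rewrite (bigD1 i)//= eqxx scale1r big1 ?addr0// => j /negPf ->; rewrite scale0r.
  have -> : h y =
      \det (A y *m metric (FramedBundle b' s') y *m map_mx Num.conj (A y)^T).
    congr determinant; apply/matrixP => i j; rewrite !mxE /=.
    rewrite -dotE//= !frameA// dot_sum exchange_big; apply: eq_bigr => k _ /=.
    by rewrite !mxE mulr_suml; apply: eq_bigr => l _; rewrite !mxE.
  rewrite !det_mulmx -/(a y) -/(h' y) mulrAC; congr (_ * _ * _).
  by rewrite -[LHS]/(\det (map_mx _ _)) det_map_mx det_tr.
pose L (g : Cm -> C) y := ((ln (complex.Re (g y)))%:C)%C.
have Rpos' y : W y -> 0 < complex.Re (h' y).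
  by move=> /hpos'; rewrite ltcE => /andP[].
have LE y : W y -> L h y = L (fun y => a y * ((a y)^*)%C) y + L h' y.
  move=> Wy; have := hpos' y Wy; rewrite ltcE /= => /andP[/eqP i0 r0].
  rewrite /L hE// cReM i0 mulr0 subr0 lnM ?posrE ?sqmod_gt0 ?a0//.
  by rewrite complexD addr0.
have Qreal (x : R) : ((x%:C)^*)%C = (x%:C)%C :> C by exact: conjc_R.
have sa y v1 v2 (Q : C -> Prop) : W y -> slice Q a y v1 v2.
  by move=> Wy; apply: slice_det => i j; exact: slice_entry oW Wy hA.
have t1 : twice_lder W (L (fun y => a y * ((a y)^*)%C)).
  apply: (twice_lder_ln oW Qreal).
    by move=> y Wy; exact: sqmod_gt0 (a0 y Wy).
  move=> y v1 v2 Wy.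
  exact: (sliceM (sa y v1 v2 _ Wy) (slice_conj (fun _ => id) (sa y v1 v2 _ Wy))).
have t2 : twice_lder W (L h').
  apply: (twice_lder_ln oW Qreal Rpos') => y v1 v2 Wy.
  exact: slice_gram_det oW Wy hs'.
have LL i j : wirtinger i (wirtinger_bar j (L h)) z =
    wirtinger i (wirtinger_bar j (L h')) z.
  have LD := @wirtinger2D R m W (L (fun y => a y * ((a y)^*)%C)) (L h') (L h) z i j
    oW Wz LE t1 t2.
  have sT y v1 v2 : W y -> slice (fun=> True) a y v1 v2 by exact: sa.
  have L0 := wirtinger2_log_modulus i j oW Wz a0 sT.
  by apply: (etrans LD); rewrite -[RHS]add0r; congr (_ + _); exact: L0.
apply: eq_bigr => i _; apply: eq_bigr => j _.
exact: (congr1 (fun x => x * dw_dwbar i j u v) (LL i j)).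
Qed.

End Main.

Theorem theorem3p4 (R : realType) (m : nat) (Omega : set 'rV[R[i]]_m)
  (Omega_open : open Omega) (Omega_connected : connected Omega)
  (Omega_nonempty : Omega !=set0) (Omega_bounded : bounded_set Omega)
  (H H' : analyticHilbertModule Omega)
  (I I' : set (mpoly m R[i])) (hI : poly_ideal I) (hI' : poly_ideal I')
  (M : set H) (M' : set H')
  (hM : M = ideal_closure H I) (hM' : M' = ideal_closure H' I')
  (K : 'rV[R[i]]_m -> H) (K' : 'rV[R[i]]_m -> H')
  (hK : reproducing_kernel M K) (hK' : reproducing_kernel M' K')
  (D : forall w, Omega w -> localDecomposition M K w)
  (D' : forall w, Omega w -> localDecomposition M' K' w) :
  sheaf_equiv D D' ->
  forall w (hw : Omega w), zero_set M w ->
    let E := P_bundle (D w hw) in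
    let E' := P_bundle (D' w hw) in
    exists W : set 'rV[R[i]]_m,
      [/\ open W, W w, W `<=` fb_base E `&` fb_base E' &
          forall z, W z -> forall u v,
            curvature (det_metric E) z u v = curvature (det_metric E') z u v].
Proof.
move=> [equivP _] w hw Zw E E'; have [W [oW Ww WE EE']] := equivP w hw Zw.
have hs i : antiholomorphic_on W (@ld_sec _ _ _ _ _ _ _ (D w hw) i).
  by apply: antiholomorphicS (ld_sec_antiholomorphic (l := D w hw) i) => y /WE[].
have hs' i : antiholomorphic_on W (@ld_sec _ _ _ _ _ _ _ (D' w hw) i).
  by apply: antiholomorphicS (ld_sec_antiholomorphic (l := D' w hw) i) => y /WE[].
exists W; split; [exact: oW|exact: Ww|exact: WE|].
refine (@curvature_det_equiv _ _ _ _ _ W E E' oW hs hs' _ EE') => y /WE[_ Wy].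
exact: (ld_sec_free (l := D' w hw) Wy).
Qed.
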